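(* Let $\Delta\subset\mathbb R^n$ be an $n$-dimensional simple polytope. Then there exists a smooth function $f\colon\Delta\to\mathbb R$ with property (A) below. Moreover, suppose we are given data $\{(x_F,\alpha_F): F \text{ a face of }\Delta\}$ where, for each face $F$, $x_F\in\mathrm{rel\text{-}int}(F)$ and $\alpha_F\in\mathbb R_{\ge0}$, and where $\alpha_F<\alpha_{F'}$ whenever $F'$ is a proper subface of $F$. Then $f$ can be chosen to have properties (A), (B) and (C): (A) For every face $F$ of $\Delta$, the minimal value of $f$ on $F$ is attained at exactly one point in the relative interior of $F$, and the restriction of $f$ to the relative interior of $F$ has no other critical points. (B) For each face $F$ of $\Delta$, the restriction $f|_{\mathrm{rel\text{-}int}(F)}$ attains its minimum at the chosen point $x_F$, and $f(x_F)=\alpha_F$. (C) For each $\ell$-dimensional face $F$ of $\Delta$, there exist $\varepsilon>0$, a neighbourhood $U_{x_F}$ of $x_F$ in $\Delta$, and affine local coordinates $(x_1,\dots,x_\ell,y_1,\dots,y_{n-\ell})$ near $x_F$ such that in these coordinates $U_{x_F}$ is $(-\varepsilon,\varepsilon)^\ell\times[0,\varepsilon)^{n-\ell}$, the point $x_F$ is the origin, and $$f|_{U_{x_F}}(x_1,\dots,x_\ell,y_1,\dots,y_{n-\ell})=\sum_{j=1}^\ell x_j^2-\sum_{j=1}^{n-\ell}y_j$$ up to an affine transformation of $\mathbb R$ (i.e. up to multiplication by a nonzero constant and addition of a constant).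
   Context: A polytope is the convex hull of a finite set of points. A (nonempty) face of $\Delta$ is its intersection $\Delta\cap\{L=\lambda\}$ with a supporting hyperplane, where $L$ is a linear functional with $L|_\Delta\ge\lambda$; vertices and $\Delta$ itself are faces. The dimension of a polytope is that of its affine span; facets are faces of codimension one. $\Delta$ is simple if every face of codimension $k$ is contained in no more than $k$ facets. $\mathrm{rel\text{-}int}(F)$ is the interior of $F$ in its affine span (for a vertex it is the vertex itself, which counts as a critical point). A function on a subset $X\subset\mathbb R^n$ is smooth if near each point of $X$ it extends to a smooth function on an open subset of $\mathbb R^n$. *)

(* Defs.v *)
From mathcomp Require Import all_boot all_order all_algebra.
From mathcomp Require Import all_classical all_reals all_analysis.

Set Implicit Arguments.
Unset Strict Implicit.
Unset Printing Implicit Defensive.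

Import Order.TTheory GRing.Theory Num.Theory.
Import numFieldNormedType.Exports.

Local Open Scope classical_set_scope.
Local Open Scope card_scope.
Local Open Scope ring_scope.

Definition convex_hull (R : realType) (n : nat) (X : set 'rV[R]_n) :
    set 'rV[R]_n :=
  [set x | exists (m : nat) (p : 'I_m -> 'rV[R]_n) (w : 'I_m -> R),
    [/\ forall i, X (p i), forall i, 0 <= w i, \sum_(i < m) w i = 1
      & x = \sum_(i < m) w i *: p i]].

Definition affine_span (R : realType) (n : nat) (X : set 'rV[R]_n) :
    set 'rV[R]_n :=
  [set x | exists (m : nat) (p : 'I_m -> 'rV[R]_n) (w : 'I_m -> R),
    [/\ forall i, X (p i), \sum_(i < m) w i = 1
      & x = \sum_(i < m) w i *: p i]].

Definition polytope (R : realType) (n : nat) (D : set 'rV[R]_n) : Prop :=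
  exists S : set 'rV[R]_n, finite_set S /\ D = convex_hull S.

(* The affine span of [X] is a translate of a linear subspace of dimension [d].
   The empty set has no dimension. *)
Definition has_dim (R : realType) (n : nat) (X : set 'rV[R]_n) (d : nat) :
    Prop :=
  exists (x0 : 'rV[R]_n) (V : {vspace 'rV[R]_n}),
    affine_span X = [set x | x - x0 \in V] /\ \dim V = d.

(* The functional [L] may be zero, so that [D] is a face of itself. *)
Definition face (R : realType) (n : nat) (D F : set 'rV[R]_n) : Prop :=
  F !=set0 /\
  exists (L : {scalar 'rV[R]_n}) (l : R),
    (forall x, D x -> l <= L x) /\ F = D `&` [set x | L x = l].

Definition face_of_codim (R : realType) (n : nat) (D : set 'rV[R]_n) (k : nat)
    (F : set 'rV[R]_n) : Prop :=
  face D F /\ exists d : nat, has_dim F d /\ has_dim D (d + k).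

Definition facet (R : realType) (n : nat) (D F : set 'rV[R]_n) : Prop :=
  face_of_codim D 1 F.

Definition simple_polytope (R : realType) (n : nat) (D : set 'rV[R]_n) : Prop :=
  polytope D /\
  forall (k : nat) (F : set 'rV[R]_n), face_of_codim D k F ->
    [set G | facet D G /\ F `<=` G] #<= `I_k.

(* Interior in the subspace topology of the affine span; for a singleton this
   is the point itself. *)
Definition rel_int (R : realType) (n : nat) (F : set 'rV[R]_n) :
    set 'rV[R]_n :=
  [set x | F x /\ within (affine_span F) (nbhs x) F].

Fixpoint C_k (R : realType) (n k : nat) (U : set 'rV[R]_n)
    (g : 'rV[R]_n -> R) : Prop :=
  match k with
  | 0%N => forall x, U x -> {for x, continuous g}
  | j.+1 => (forall x, U x -> differentiable g x) /\
            (forall v : 'rV[R]_n, C_k j U (fun x => 'D_v g x))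
  end.

(* A function on [X] is represented by a total function, of which only the
   values on [X] matter. *)
Definition smooth_on (R : realType) (n : nat) (X : set 'rV[R]_n)
    (f : 'rV[R]_n -> R) : Prop :=
  forall x, X x ->
    exists (U : set 'rV[R]_n) (g : 'rV[R]_n -> R),
      [/\ open U, U x, forall k, C_k k U g
        & forall y, U y -> X y -> g y = f y].

(* The vectors [v] with [x + v] in the affine span of [F] are those tangent to
   [F].  For [x] in the relative interior of [F] and such [v], ['D_v f x] only
   depends on the values of [f] on that relative interior. *)
Definition critical_point (R : realType) (n : nat) (F : set 'rV[R]_n)
    (f : 'rV[R]_n -> R) (x : 'rV[R]_n) : Prop :=
  rel_int F x /\ forall v, affine_span F (x + v) -> 'D_v f x = 0.

Definition property_A (R : realType) (n : nat) (D : set 'rV[R]_n)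
    (f : 'rV[R]_n -> R) : Prop :=
  forall F, face D F ->
    exists x, [/\ rel_int F x,
      forall y, F y -> y <> x -> f x < f y
    & forall y, critical_point F f y -> y = x].

Definition property_B (R : realType) (n : nat) (D : set 'rV[R]_n)
    (xF : set 'rV[R]_n -> 'rV[R]_n) (alpha : set 'rV[R]_n -> R)
    (f : 'rV[R]_n -> R) : Prop :=
  forall F, face D F ->
    [/\ rel_int F (xF F),
        forall y, rel_int F y -> f (xF F) <= f y
      & f (xF F) = alpha F].

(* The affine coordinates of [p] are the entries of [p *m A + b].  Those of
   index [i < l] are the x-coordinates, the other ones the y-coordinates. *)
Definition affine_coord (R : realType) (n : nat) (A : 'M[R]_n) (b : 'rV[R]_n)
    (p : 'rV[R]_n) (i : 'I_n) : R := (p *m A + b) 0 i.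

Definition coord_box (R : realType) (n l : nat) (e : R) (c : 'I_n -> R) :
    Prop :=
  forall i : 'I_n, if (i < l)%N then - e < c i < e else 0 <= c i < e.

Definition normal_form (R : realType) (n l : nat) (c : 'I_n -> R) : R :=
  \sum_(i < n | (i < l)%N) c i ^+ 2 - \sum_(i < n | (l <= i)%N) c i.

Definition property_C (R : realType) (n : nat) (D : set 'rV[R]_n)
    (xF : set 'rV[R]_n -> 'rV[R]_n) (f : 'rV[R]_n -> R) : Prop :=
  forall (F : set 'rV[R]_n) (l : nat), face D F -> has_dim F l ->
    exists (e : R) (U : set 'rV[R]_n) (A : 'M[R]_n) (b : 'rV[R]_n),
      [/\ 0 < e,
          U `<=` D /\ within D (nbhs (xF F)) U,
          A \in unitmx /\ (forall i, affine_coord A b (xF F) i = 0),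
          U = [set p | coord_box l e (affine_coord A b p)]
        & exists r s : R, r != 0 /\
            forall p, U p -> f p = r * normal_form l (affine_coord A b p) + s].

Definition face_data (R : realType) (n : nat) (D : set 'rV[R]_n)
    (xF : set 'rV[R]_n -> 'rV[R]_n) (alpha : set 'rV[R]_n -> R) : Prop :=
  [/\ forall F, face D F -> rel_int F (xF F),
      forall F, face D F -> 0 <= alpha F
    & forall F F', face D F -> face D F' -> F' `<` F -> alpha F < alpha F'].

(* Main.v *)
(** On the relative interior of a face [F] put affine coordinates (x, y) centred
    at [x_F], where the [y_j] are the defining forms of the facets through [F]
    (independent because the polytope is simple), and let
    q_F = alpha_F + delta (sum x_j^2 - kappa sum y_j).  This is a convex quadratic
    with q_F(x_F) = alpha_F and q_F > alpha_F on the rest of [F].  For [delta]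
    small and then [kappa] large, q_F(x_G) < alpha_G for every other face [G]:
    if G is a proper face of F then the y-terms vanish at x_G and
    alpha_F < alpha_G, otherwise sum y_j > 0 at x_G.  So near x_F the maximum of
    all the q_G is q_F, and a smooth convex regularisation [f] of this maximum
    still coincides with q_F there and dominates q_F everywhere.  Hence x_F is the
    strict minimum of [f] on [F], and convexity excludes any other critical
    point, as it makes the derivative of [f] at y in the direction x_F - y
    at most f(x_F) - f(y) < 0. *)

From HB Require Import structures.
Require Import Defs.
From mathcomp Require Import all_boot all_order all_algebra.
From mathcomp Require Import all_classical all_reals all_analysis.
From mathcomp Require Import ring lra.

Set Implicit Arguments.
Unset Strict Implicit.
Unset Printing Implicit Defensive.

Import Order.TTheory GRing.Theory Num.Theory.
Import numFieldNormedType.Exports.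

Local Open Scope classical_set_scope.
Local Open Scope ring_scope.

(** * Smooth functions on a normed space *)

(** All functions of the construction are defined everywhere, so no domain is carried along. The
    space is general because both [R] and ['rV[R]_n] occur. *)
Fixpoint cdiff (R : realType) (V : normedModType R) (k : nat) (g : V -> R) :
    Prop :=
  match k with
  | 0%N => continuous g
  | j.+1 => (forall x, differentiable g x) /\ forall v, cdiff j ('D_v g)
  end.

Definition smooth (R : realType) (V : normedModType R) (g : V -> R) :=
  forall k, cdiff k g.

Section Cdiff.
Context {R : realType} {V : normedModType R}.
Implicit Types (f g : V -> R) (h : R -> R).

Lemma cdiffW k g : cdiff k.+1 g -> cdiff k g.
Proof.
elim: k g => [|k IHk] g [dg Dg]; first exact: (fun x => differentiable_continuous (dg x)).
by split=> // v; apply/IHk/Dg.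
Qed.

Lemma cdiff_cst k (c : R) : cdiff k (cst c : V -> R).
Proof.
elim: k c => [|k IHk] c /=; first exact: cst_continuous.
split=> [x|v]; first exact: differentiable_cst.
by rewrite (_ : 'D_v _ = cst 0) //; apply/funext => x; rewrite derive_cst.
Qed.

Lemma cdiff_lin k (f : {linear V -> R}) : continuous f -> cdiff k f.
Proof.
case: k => [//|k] cf; split=> [x|v]; first exact: linear_differentiable.
rewrite (_ : 'D_v f = cst (f v)); first exact: cdiff_cst.
apply/funext => x; rewrite deriveE; last exact: linear_differentiable.
by rewrite diff_lin.
Qed.

Lemma cdiffD k f g : cdiff k f -> cdiff k g -> cdiff k (f + g).
Proof.
elim: k f g => [|k IHk] f g; first by move=> cf cg x; apply: continuousD; [exact: cf|exact: cg].
move=> [df Df] [dg Dg]; split=> [x|v]; first exact: differentiableD.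
rewrite (_ : 'D_v _ = 'D_v f + 'D_v g); first exact: (IHk _ _ (Df v) (Dg v)).
by apply/funext => x; apply: deriveD; apply: diff_derivable.
Qed.

Lemma cdiffM k f g : cdiff k f -> cdiff k g -> cdiff k (f * g).
Proof.
elim: k f g => [|k IHk] f g; first by move=> cf cg x; apply: continuousM; [exact: cf|exact: cg].
move=> Cf Cg; have [df Df] := Cf; have [dg Dg] := Cg.
split=> [x|v]; first exact: differentiableM.
rewrite (_ : 'D_v _ = (f * 'D_v g) + (g * 'D_v f)).
  by apply: cdiffD; [apply: IHk (cdiffW Cf) (Dg v)|apply: IHk (cdiffW Cg) (Df v)].
by apply/funext => x; apply: deriveM; apply: diff_derivable.
Qed.

Lemma derive_comp1 h g v x : differentiable h (g x) -> differentiable g x ->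
  'D_v (h \o g) x = 'D_1 h (g x) * 'D_v g x.
Proof.
move=> dh dg; rewrite deriveE; last exact: differentiable_comp.
rewrite diff_comp //= !deriveE // -[X in 'd h _ X]mulr1.
by rewrite [X in 'd h _ X = _]( _ : _ = ('d g x v) *: (1 : R)) // linearZ mulrC.
Qed.

Lemma cdiff_comp k h g : cdiff k h -> cdiff k g -> cdiff k (h \o g).
Proof.
elim: k h g => [|k IHk] h g.
  by move=> ch cg x; apply: continuous_comp; [exact: cg|exact: ch].
move=> Ch Cg; have [dh Dh] := Ch; have [dg Dg] := Cg.
split=> [x|v]; first exact: differentiable_comp.
rewrite (_ : 'D_v _ = ('D_1 h \o g) * 'D_v g).
  by apply: cdiffM (Dg v); apply: IHk (Dh 1) (cdiffW Cg).
by apply/funext => x; rewrite derive_comp1.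
Qed.

End Cdiff.

Section Cdiff1.
Context {R : realType}.
Implicit Types (h g : R -> R).

(** On the line every ['D_v h] is [v] times the derivative in direction 1, so a single derivative
    controls the class. *)
Lemma cdiff1S k h g : (forall x : R, is_derive x (1:R) h (g x)) -> cdiff k g ->
  cdiff k.+1 h.
Proof.
move=> hg Cg.
have dh x : differentiable h x by apply/derivable1_diffP; case: (hg x).
split=> // v; rewrite (_ : 'D_v h = (cst v : R -> R) * g).
  by apply: cdiffM => //; apply: cdiff_cst.
apply/funext => x; rewrite deriveE // -[X in 'd h _ X]mulr1.
by rewrite [X in 'd h _ X = _]( _ : _ = v *: (1 : R)) // linearZ -deriveE //; case: (hg x) => _ ->.
Qed.

End Cdiff1.

(** * Functions flat at the origin *)

Section Flat.
Context {R : realType}.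
Implicit Types (p : {poly R}) (t : R).

(* This family contains exp(-1/t) and is stable under differentiation. *)
Definition flat p t : R := if 0 < t then p.[t^-1] * expR (- t^-1) else 0.

(** For [u > 0] the exponential series gives u^i exp(-u) <= i!; the bound follows by summing over
    the coefficients. *)
Lemma poly_expR_bounded p : exists C : R, forall u : R, 0 < u ->
  `|p.[u] * expR (- u)| <= C.
Proof.
exists (\sum_(i < size p) `|p`_i| * i`!%:R) => u u0.
rewrite horner_coef mulr_suml (le_trans (ler_norm_sum _ _ _)) // ler_sum // => i _.
rewrite -mulrA normrM ler_wpM2l // ger0_norm; last first.
  by rewrite mulr_ge0 ?expR_ge0 // exprn_ge0 // ltW.
rewrite expRN ler_pdivrMr ?expR_gt0 //.
case: (i : nat) => [|k]; first by rewrite expr0 fact0 mul1r ltW // pexpR_gt1.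
have := expR_ge1Dxn k (ltW u0); rewrite -ler_pdivrMl ?ltr0n ?fact_gt0 //.
by apply: le_trans; rewrite mulrC lerDr.
Qed.

(** The preceding bound for ['X * p], taken at u = 1/t, yields |flat p t| <= C |t|. *)
Lemma flat_continuous0 p : {for (0 : R), continuous (flat p)}.
Proof.
have [C HC] := poly_expR_bounded ('X * p).
have C0 : 0 <= C by apply: le_trans (HC 1 ltr01).
have bnd z : `|flat p z| <= C * `|z|.
  rewrite /flat; case: ifP => z0; last by rewrite normr0 mulr_ge0.
  have zi : 0 < z^-1 by rewrite invr_gt0.
  have := HC _ zi; rewrite hornerM hornerX -mulrA normrM (gtr0_norm zi).
  by rewrite (gtr0_norm z0) mulrC ler_pdivrMr.
have f0 : flat p 0 = 0 by rewrite /flat ltxx.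
suff : flat p z @[z --> (0 : R)] --> (0 : R) by rewrite -[X in _ --> X]f0.
have C1 : 0 < C + 1 by rewrite ltr_wpDl.
apply/cvgr0Pnorm_le => e e0.
have e1 : 0 < e / (C + 1) by rewrite divr_gt0.
apply: filterS (@nbhs0_le R R _ e1) => z ze; apply: le_trans (bnd z) _.
apply: (@le_trans _ _ ((C + 1) * `|z|)); first by rewrite ler_wpM2r // lerDl.
by rewrite mulrC -ler_pdivlMr.
Qed.

(** For t > 0 this is the chain rule in u = 1/t, with du/dt = -u^2. At 0 the difference quotient of
    [flat p] is [flat ('X * p)], which is continuous there, and Caratheodory's criterion applies. *)
Lemma is_derive_flat p t :
  is_derive t (1 : R) (flat p) (flat ('X^2 * (p - p^`())) t).
Proof.
have [t0|t0|->] := ltgtP t 0.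
- rewrite [X in is_derive _ _ _ X]/flat ltNge (ltW t0) /=.
  apply: (@near_eq_is_derive _ _ _ (cst 0)).
  near=> z; rewrite /flat ltNge ltW //.
  by near: z; apply: lt_nbhsl.
- rewrite [X in is_derive _ _ _ X]/flat t0.
  apply: (@near_eq_is_derive _ _ _ ((horner p * (expR \o -%R)) \o GRing.inv)).
    by near=> z; rewrite /flat ifT //; near: z; exact: lt_nbhsr.
  have di : is_derive t (1 : R) (GRing.inv : R -> R) (- t ^- 2).
    apply: trigger_derive (_ : is_derive t 1 _ (- t ^- 2 *: (1 : R))) _.
      by apply: (@is_deriveV _ id) => //; rewrite gt_eqF.
    by rewrite [_ *: _]mulr1.
  have de : is_derive t^-1 (1 : R) (expR \o -%R) (expR (- t^-1) * -1).
    exact: is_derive1_comp.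
  have dp := is_deriveM (is_derive_poly p t^-1) de.
  have := @is_derive1_comp _ _ GRing.inv t _ _ dp di.
  move/trigger_derive; apply.
  rewrite !hornerE /= -![_ *: _]/(_ * _) /=.
  by field; rewrite gt_eqF //.
- rewrite [X in is_derive _ _ _ X]/flat ltxx; apply/is_derive1_caratheodory.
  exists (flat ('X * p)); split; last 2 first.
  + exact: flat_continuous0.
  + by rewrite /flat ltxx.
  move=> z; rewrite /flat ltxx !subr0; case: ifP => z0; last by rewrite mul0r.
  by rewrite !hornerE; field; rewrite gt_eqF.
Unshelve. all: end_near. Qed.

Lemma smooth_flat p : smooth (flat p).
Proof.
move=> k; elim: k p => [|k IHk] p.
  by move=> t; have [+ _] := is_derive_flat p t; move/derivable1_diffP/differentiable_continuous.
exact: cdiff1S (is_derive_flat p) (IHk _).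
Qed.

End Flat.

(** * A smooth convex hinge *)

Section Hinge.
Context {R : realType}.

Lemma is_derive_MVT (F f : R -> R) (a b : R) :
  (forall x, is_derive x (1 : R) F (f x)) -> a <= b ->
  exists2 c, a <= c <= b & F b - F a = f c * (b - a).
Proof.
move=> dF ab; have cF : {within `[a, b], continuous F}.
  apply: continuous_subspaceT => x.
  by have [+ _] := dF x; move/derivable1_diffP/differentiable_continuous.
have [c cab E] := MVT_segment ab (fun x _ => dF x) cF.
by exists c => //; rewrite in_itv in cab.
Qed.

(** The integral starts at -1 rather than 0, so that the fundamental theorem, valid to the right of
    the lower bound, covers 0 as well; further left both functions vanish locally. *)
Lemma antiderivative (f : R -> R) :
  continuous f -> (forall x, x <= 0 -> f x = 0) ->
  exists F : R -> R, (forall x, is_derive x (1 : R) F (f x)) /\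
    forall x, x <= 0 -> F x = 0.
Proof.
move=> cf f0; pose F (x : R) := (\int[@lebesgue_measure R]_(t in `[(-1)%R, x]) f t)%R.
have F0 x : x <= 0 -> F x = 0.
  move=> x0; rewrite /F /Rintegral integral0_eq // => t /=.
  by rewrite in_itv /= => /andP[_ tx]; rewrite f0 // (le_trans tx).
exists F; split=> // x; have [x1|x0] := ltP (- 1) x.
  have xx1 : x < x + 1 by rewrite ltrDl.
  have fi : (@lebesgue_measure R).-integrable `[(-1), x + 1] (EFin \o f).
    apply: continuous_compact_integrable; first exact: segment_compact.
    exact: continuous_subspaceT.
  have [dF FE] := continuous_FTC1_closed xx1 fi x1 (cf x).
  by rewrite -FE derive1E; apply: derivableP.
have {}x0 : x < 0 by rewrite (le_lt_trans x0) // ltrN10.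
rewrite f0 ?ltW //; apply: (@near_eq_is_derive _ _ _ (cst 0)).
by near=> z; rewrite F0 // ltW //; near: z; apply: lt_nbhsl.
Unshelve. all: end_near. Qed.

Lemma smooth_affine (a b : R) : smooth (fun t : R => a * t + b).
Proof.
move=> k; apply: (@cdiffD _ _ _ (fun t : R => a * t) (cst b)); last exact: cdiff_cst.
apply: (@cdiffM _ _ _ (cst a) id); first exact: cdiff_cst.
by apply: (@cdiff_lin _ _ _ idfun) => x; apply: cvg_id.
Qed.

(** The argument t - t^2 is positive exactly on the open interval from 0 to 1. *)
Definition bump (t : R) : R := flat 1 (t - t ^+ 2).

Lemma smooth_bump : smooth bump.
Proof.
move=> k; apply: (@cdiff_comp _ _ _ (flat 1) (fun t : R => t - t ^+ 2)).
  exact: smooth_flat.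
rewrite (_ : (fun t : R => _) = (fun t : R => (-1) * t + 1) * (fun t : R => 1 * t + 0)).
  by apply: cdiffM; apply: smooth_affine.
by apply/funext => t; change (t - t ^+ 2 = (-1 * t + 1) * (1 * t + 0)); ring.
Qed.

Lemma bump_ge0 t : 0 <= bump t.
Proof.
by rewrite /bump /flat; case: ifP => // _; rewrite hornerE mul1r expR_ge0.
Qed.

Lemma bump_gt0 t : 0 < t < 1 -> 0 < bump t.
Proof.
move=> /andP[t0 t1]; rewrite /bump /flat ifT; last by nra.
by rewrite hornerE mul1r expR_gt0.
Qed.

Lemma bump_eq0 t : (t <= 0) || (1 <= t) -> bump t = 0.
Proof.
move=> t01; rewrite /bump /flat ifF //; apply/negbTE; rewrite -leNgt.
by case/orP: t01 => t01; nra.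
Qed.

(** Integrate [bump] twice. The first integral [s] is nondecreasing and constant from 1 on, so the
    second one is affine there; dividing by [s 1] makes the final slope 1. *)
Lemma smooth_ramp : exists (h s : R -> R) (d : R),
  [/\ smooth h, forall x, is_derive x (1 : R) h (s x),
      {homo s : x y / x <= y}, forall t, t <= 0 -> h t = 0
    & forall t, 1 <= t -> h t = t + d].
Proof.
have [s [ds s0]] : exists F : R -> R, (forall x, is_derive x (1 : R) F (bump x)) /\
    forall x, x <= 0 -> F x = 0.
  apply: antiderivative; first exact: (smooth_bump 0).
  by move=> x x0; rewrite bump_eq0 ?x0.
have [h [dh h0]] : exists F : R -> R, (forall x, is_derive x (1 : R) F (s x)) /\
    forall x, x <= 0 -> F x = 0.
  apply: antiderivative s0.
  exact: (cdiffW (cdiff1S ds (smooth_bump 0))).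
have s_mono : {homo s : x y / x <= y}.
  move=> x y xy; have [c _ E] := is_derive_MVT ds xy.
  by rewrite -subr_ge0 E mulr_ge0 ?bump_ge0 // subr_ge0.
have s1 t : 1 <= t -> s t = s 1.
  move=> t1; have [c /andP[c1 _] E] := is_derive_MVT ds t1.
  by apply/eqP; rewrite -subr_eq0 E bump_eq0 ?c1 ?orbT // mul0r.
have s1_gt0 : 0 < s 1.
  (* The mean value point may be an endpoint, so the interval is kept strictly inside the region
     where [bump] is positive. *)
  have h12 : 3^-1 <= 2 / 3 :> R by lra.
  have [c /andP[c1 c2] E] := is_derive_MVT ds h12.
  have : 0 < s (2 / 3) - s 3^-1.
    by rewrite E mulr_gt0 //; [apply: bump_gt0|]; lra.
  have : s (2 / 3) <= s 1 by apply: s_mono; lra.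
  have : s 0 <= s 3^-1 by apply: s_mono; lra.
  by rewrite s0 //; lra.
exists (fun t => (s 1)^-1 * h t), (fun t => (s 1)^-1 * s t), ((s 1)^-1 * h 1 - 1).
split=> [k|t|x y xy|t t0|t t1].
- apply: (@cdiffM _ _ _ (cst _) h); first exact: cdiff_cst.
  by apply: cdiffW; apply: cdiff1S dh _; apply: cdiffW; apply: cdiff1S ds (smooth_bump k).
- exact: (is_deriveZ (s 1)^-1 (dh t)).
- by rewrite ler_pM2l ?invr_gt0 // s_mono.
- by rewrite h0 ?mulr0.
- have [c /andP[c1 _] E] := is_derive_MVT dh t1.
  have -> : h t = h 1 + s 1 * (t - 1) by rewrite -(s1 c) // -E; ring.
  by field; rewrite gt_eqF.
Qed.

(** Rescale the ramp to h(k t - d) / k: the shift by d cancels the additive constant, and k e = |d|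
    + 1 sends [e] to at least 1 and [- e] to at most 0. *)
Lemma smooth_hinge (e : R) : 0 < e -> exists h s : R -> R,
  [/\ smooth h, forall x, is_derive x (1 : R) h (s x),
      {homo s : x y / x <= y}, forall t, t <= - e -> h t = 0
    & forall t, e <= t -> h t = t].
Proof.
move=> e0; have [h [s [d [Ch dh s_mono h0 h1]]]] := smooth_ramp.
have [k k0 kd] : exists2 k : R, 0 < k & (`|d| + 1) = k * e.
  by exists ((`|d| + 1) / e); rewrite ?divfK ?gt_eqF // divr_gt0 // ltr_wpDl.
have [d1 d2] : d <= `|d| /\ - d <= `|d| by rewrite -normrN !ler_norm normrN ler_norm.
exists (fun t => k^-1 * h (k * t + - d)), (fun t => s (k * t + - d)).
split=> [j|t|x y xy|t te|t te].
- apply: (@cdiffM _ _ _ (cst _) (h \o (fun t => k * t + - d))); first exact: cdiff_cst.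
  by apply: cdiff_comp => //; apply: smooth_affine.
- have da : is_derive t (1 : R) (fun t : R => k * t + - d) k.
    have := is_deriveD (is_deriveZ k (is_derive_id t (1 : R))) (is_derive_cst (- d) t 1).
    by move/trigger_derive; apply; rewrite addr0 [_ *: _]mulr1.
  have := is_deriveZ k^-1 (is_derive1_comp (dh _) da).
  by move/trigger_derive; apply; rewrite [_ *: _]mulrC mulfK // gt_eqF.
- by apply: s_mono; rewrite lerD2r ler_pM2l.
- by rewrite h0 ?mulr0 //; nra.
- by rewrite h1; [field; rewrite gt_eqF|nra].
Qed.

End Hinge.

(** * Smooth convex functions and regularised maxima *)

Section SmoothConvex.
Context {R : realType} {V : normedModType R}.
Implicit Types f g : V -> R.

(** Convexity in its tangent form: it is preserved by purely algebraic arguments and bears directly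
    on critical points. *)
Definition smooth_convex f :=
  smooth f /\ forall x y, f x + 'D_(y - x) f x <= f y.

Lemma smooth_derivable f x v : smooth f -> derivable f x v.
Proof. by move=> Cf; apply: diff_derivable; apply: (Cf 1).1. Qed.

Lemma smooth_convex_cst c : smooth_convex (cst c).
Proof.
split=> [k|x y]; first exact: cdiff_cst.
by rewrite derive_cst addr0.
Qed.

Lemma smooth_convex_lin (f : {linear V -> R}) : continuous f -> smooth_convex f.
Proof.
move=> cf; split=> [k|x y]; first exact: cdiff_lin.
rewrite deriveE; last exact: linear_differentiable.
by rewrite diff_lin // -linearD addrC subrK.
Qed.

Lemma smooth_convexD f g :
  smooth_convex f -> smooth_convex g -> smooth_convex (f + g).
Proof.
move=> [Cf Tf] [Cg Tg]; split=> [k|x y]; first exact: cdiffD.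
rewrite deriveD; [|exact: smooth_derivable..].
by have := lerD (Tf x y) (Tg x y); rewrite addrACA.
Qed.

Lemma smooth_convexZ c f :
  0 <= c -> smooth_convex f -> smooth_convex (c *: f).
Proof.
move=> c0 [Cf Tf]; split=> [k|x y].
  by apply: (@cdiffM _ _ _ (cst c) f); first exact: cdiff_cst.
rewrite deriveZ; last exact: smooth_derivable.
by have := ler_wpM2l c0 (Tf x y); rewrite mulrDr.
Qed.

(** The two convexity hypotheses make f affine, and the tangent inequality for its square reduces to
    (f y - f x)^2 >= 0. *)
Lemma smooth_convex_sqr f : smooth f -> smooth_convex f -> smooth_convex (- f) ->
  smooth_convex (f * f).
Proof.
move=> Cf [_ Tf] [_ Tnf]; split=> [k|x y]; first exact: cdiffM.
rewrite deriveM; [|exact: smooth_derivable..].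
have := Tf x y; have := Tnf x y.
rewrite deriveN; last exact: smooth_derivable.
change ((f * f) x) with (f x * f x); change ((f * f) y) with (f y * f y).
change ((- f) x) with (- f x); change ((- f) y) with (- f y).
rewrite -![_ *: _]/(_ * _); move: ('D_(y - x) f x) => D H1 H2.
have -> : D = f y - f x by lra.
by rewrite -subr_ge0; have := sqr_ge0 (f y - f x); nra.
Qed.

Lemma smooth_convex_sum (I : Type) (r : seq I) (P : pred I) (F : I -> V -> R) :
  (forall i, P i -> smooth_convex (F i)) ->
  smooth_convex (fun x => \sum_(i <- r | P i) F i x).
Proof.
move=> TF; elim: r => [|i r IHr].
  rewrite (_ : (fun _ => _) = cst 0); first exact: smooth_convex_cst.
  by apply/funext => x; rewrite big_nil.
case: (boolP (P i)) => Pi; last first.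
  by under eq_fun do rewrite big_cons (negbTE Pi).
rewrite (_ : (fun _ => _) = F i + fun x => \sum_(j <- r | P j) F j x).
  by apply: smooth_convexD IHr; apply: TF.
by apply/funext => x; rewrite big_cons Pi.
Qed.

(* max(a, b) = b + max(a - b, 0), with the second summand smoothed near a = b. *)
Lemma regularized_max2 f g (e : R) : 0 < e ->
  smooth_convex f -> smooth_convex g -> exists m : V -> R,
  [/\ smooth_convex m, forall x, f x <= m x /\ g x <= m x,
      forall x c, f x <= c -> g x <= c -> m x <= c + e,
      forall x, f x + e <= g x -> m x = g x
    & forall x, g x + e <= f x -> m x = f x].
Proof.
move=> e0 [Cf Tf] [Cg Tg]; have [h [s [Ch dh s_mono h0 h1]]] := smooth_hinge e0.
(* The hinge is convex because its slope [s] is nondecreasing. *)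
have Th a b : h a + s a * (b - a) <= h b.
  have [ab|/ltW ba] := leP a b.
    have [c /andP[ac cb] E] := is_derive_MVT dh ab.
    by rewrite -lerBrDl E ler_wpM2r ?subr_ge0 // s_mono.
  have [c /andP[bc ca] E] := is_derive_MVT dh ba.
  have : s c * (a - b) <= s a * (a - b) by rewrite ler_wpM2r ?subr_ge0 // s_mono.
  by lra.
have s0 t : t < - e -> s t = 0.
  move=> te; have /@derive_val <- := dh t.
  rewrite -(@derive_cst _ _ _ 0 t 1); apply: near_eq_derive.
  by near=> z; rewrite h0 // ltW //; near: z; apply: lt_nbhsl.
have s1 t : e < t -> s t = 1.
  move=> te; have /@derive_val <- := dh t.
  rewrite -[RHS](@derive_id _ _ t 1); apply: near_eq_derive.
  by near=> z; rewrite h1 // ltW //; near: z; apply: lt_nbhsr.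
have s_ge0 t : 0 <= s t.
  rewrite -(s0 (Num.min t (- e) - 1)) ?s_mono //.
    by rewrite lerBlDr ge_min lerDl ler01.
  by rewrite ltrBlDr gt_min ltrDl ltr01 orbT.
have s_le1 t : s t <= 1.
  rewrite -(s1 (Num.max t e + 1)) ?s_mono //.
    by rewrite (@le_trans _ _ (Num.max t e)) ?le_max ?lexx // lerDl ler01.
  by rewrite ltr_pwDr // le_max lexx orbT.
have h_ge0 t : 0 <= h t.
  by have := Th (- e - 1) t; rewrite h0 ?s0 //; lra.
have h_ge t : t <= h t.
  by have := Th (e + 1) t; rewrite h1 ?s1 //; lra.
have h_mono a b : a <= b -> h a <= h b.
  by move=> ab; apply: le_trans (Th a b); rewrite lerDl mulr_ge0 // subr_ge0.
exists (g + (h \o (f - g))); split.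
- have Cfg : smooth (f - g).
    move=> k; apply: cdiffD => //; rewrite -scaleN1r.
    by apply: (@cdiffM _ _ _ (cst (-1)) g); first exact: cdiff_cst.
  split=> [k|x y]; first by apply: cdiffD => //; apply: cdiff_comp.
  have Chfg : smooth (h \o (f - g)) by move=> k; apply: cdiff_comp.
  rewrite deriveD; [|exact: smooth_derivable..].
  rewrite derive_comp1; [|exact: (Ch 1).1|exact: (Cfg 1).1].
  rewrite deriveB; [|exact: smooth_derivable..].
  have /@derive_val -> := dh ((f - g) x).
  change ((g + (h \o (f - g))) x) with (g x + h (f x - g x)).
  change ((g + (h \o (f - g))) y) with (g y + h (f y - g y)).
  change ((f - g) x) with (f x - g x).
  (* With t the slope of the hinge at [f x - g x], the derivative of the new function is t times
     that of f plus 1 - t times that of g. Since t lies between 0 and 1, the tangent inequalities of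
     f and g combine with these weights. *)
  have := Th (f x - g x) (f y - g y); have := s_ge0 (f x - g x).
  have := s_le1 (f x - g x).
  move: (s _) (h _) (h _) => t a b t1 t0.
  have := ler_wpM2l t0 (Tf x y).
  have t1' : 0 <= 1 - t by rewrite subr_ge0.
  have := ler_wpM2l t1' (Tg x y).
  by lra.
- move=> x; change ((g + (h \o (f - g))) x) with (g x + h (f x - g x)).
  by have := h_ge0 (f x - g x); have := h_ge (f x - g x); lra.
- move=> x c fc gc; change ((g + (h \o (f - g))) x) with (g x + h (f x - g x)).
  have [fge|/ltW fge] := leP (f x - g x) e.
    by have := h_mono _ _ fge; rewrite (h1 e) //; lra.
  by rewrite h1 //; lra.
- move=> x fg; change ((g + (h \o (f - g))) x) with (g x + h (f x - g x)).
  by rewrite h0 ?addr0 //; lra.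
- move=> x fg; change ((g + (h \o (f - g))) x) with (g x + h (f x - g x)).
  by rewrite h1 ?addr0 //; lra.
Unshelve. all: end_near. Qed.

Lemma regularized_max (I : eqType) (s : seq I) (q : I -> V -> R) (e : R) :
  0 < e -> uniq s -> s != [::] -> (forall i, i \in s -> smooth_convex (q i)) ->
  exists f : V -> R, [/\ smooth_convex f,
    forall i x, i \in s -> q i x <= f x
  & forall i x, i \in s ->
      (forall j, j \in s -> j != i -> q j x + e <= q i x) -> f x = q i x].
Proof.
move=> e0 + sn0; have n0 : 0 < (size s)%:R :> R by rewrite ltr0n lt0n size_eq0.
have [d d0 de] : exists2 d, 0 < d & d *+ size s = e.
  by exists (e / (size s)%:R); rewrite ?divr_gt0 // -[LHS]mulr_natr divfK ?gt_eqF.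
(* The induction also carries an upper bound: every binary maximum may overshoot by [d], and the
   total overshoot must be known to see that the last maximum still selects a function dominating by
   the whole margin. *)
suff: forall s : seq I, uniq s -> s != [::] -> (forall i, i \in s -> smooth_convex (q i)) ->
  exists f : V -> R, [/\ smooth_convex f,
    forall i x, i \in s -> q i x <= f x,
    forall x c, (forall i, i \in s -> q i x <= c) -> f x <= c + d *+ size s
  & forall i x, i \in s ->
      (forall j, j \in s -> j != i -> q j x + d *+ size s <= q i x) -> f x = q i x].
  move=> /[apply] /(_ sn0) /[apply] -[f [Cf qf _ fE]]; exists f; split=> // i x si.
  move=> gap; apply: fE => // j sj ji.
  by rewrite de gap.
elim=> {sn0 n0 de s} // i0 s IHs /= /andP[i0s us] _ Cq.
have d0' : 0 <= d by apply: ltW.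
have [->|sn0] := eqVneq s [::].
  exists (q i0); split=> [|i x|x c|i x]; rewrite ?inE.
  - by apply: Cq; rewrite mem_head.
  - by move/eqP ->.
  - by move=> /(_ i0); rewrite mem_head => /(_ isT) ?; rewrite ler_wpDr.
  - by move/eqP ->.
have Cqs i : i \in s -> smooth_convex (q i).
  by move=> si; apply: Cq; rewrite inE si orbT.
have [f [Cf qf f_ub fE]] := IHs us sn0 Cqs.
have [m [Cm m_ge m_ub mg mf]] := regularized_max2 d0 Cf (Cq i0 (mem_head _ _)).
exists m; split=> // [i x|x c qc|i x].
- rewrite inE => /predU1P[->|si]; first exact: (m_ge x).2.
  exact: le_trans (qf i x si) (m_ge x).1.
- rewrite mulrSr addrA; apply: m_ub; last first.
    by rewrite (le_trans (qc i0 (mem_head _ _))) // lerDl mulrn_wge0.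
  by apply: f_ub => i si; apply: qc; rewrite inE si orbT.
- rewrite inE => /predU1P[->|si] gap.
    apply: mg; rewrite -lerBrDr.
    apply: le_trans (f_ub x (q i0 x - d *+ (size s).+1) _) _.
      move=> j sj; rewrite lerBrDr gap ?inE ?sj ?orbT //.
      by apply: contraNneq i0s => <-.
    by rewrite mulrSr; lra.
  have fqi : f x = q i x.
    apply: fE => // j sj ji; apply: le_trans (gap j _ ji); last by rewrite inE sj orbT.
    by rewrite lerD2l mulrSr lerDl.
  rewrite -fqi; apply: mf; rewrite fqi.
  apply: le_trans (gap i0 (mem_head _ _) _); last first.
    by apply: contraNneq i0s => ->.
  by rewrite lerD2l mulrSr lerDr mulrn_wge0.
Qed.

End SmoothConvex.

(** * Finitely generated cones are polyhedral *)

Section Cone.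
Context {R : realType} {n : nat}.
Implicit Types (x y v : 'rV[R]_n) (a : 'cV[R]_n) (s : seq 'rV[R]_n).

Definition pairing x a : R := (x *m a) 0 0.

Lemma pairingDl x y a : pairing (x + y) a = pairing x a + pairing y a.
Proof. by rewrite /pairing mulmxDl mxE. Qed.

Lemma pairingZl c x a : pairing (c *: x) a = c * pairing x a.
Proof. by rewrite /pairing -scalemxAl mxE. Qed.

Lemma pairingBl x y a : pairing (x - y) a = pairing x a - pairing y a.
Proof. by rewrite /pairing mulmxBl !mxE. Qed.

Lemma pairingBr x a b : pairing x (a - b) = pairing x a - pairing x b.
Proof. by rewrite /pairing mulmxBr !mxE. Qed.

Lemma pairingZr c x a : pairing x (c *: a) = c * pairing x a.
Proof. by rewrite /pairing -scalemxAr mxE. Qed.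

(** Nonnegative combinations, written as nested existentials so that the coefficients can be
    eliminated one at a time. *)
Fixpoint cone s x : Prop :=
  if s is v :: s' then exists2 c : R, 0 <= c & cone s' (x - c *: v) else x = 0.

(** Provides the coefficient in the elimination below: the greatest of its lower bounds, 0 among
    them. Being attained, it has to be compared with each upper bound through one pair of
    constraints only. *)
Lemma attained_upper_bound (L : seq R) :
  exists c, [/\ 0 <= c, forall l, l \in L -> l <= c & c = 0 \/ c \in L].
Proof.
elim: L => [|l L [c [c0 Lc cE]]]; first by exists 0; split=> //; left.
have [lc|/ltW cl] := leP l c.
  exists c; split=> // [k|]; first by rewrite inE => /predU1P[->|/Lc].
  by case: cE => [->|cL]; [left|right; rewrite inE cL orbT].
exists l; split=> [|k|]; first exact: le_trans cl.
  by rewrite inE => /predU1P[->|/Lc/le_trans]; last exact.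
by right; rewrite mem_head.
Qed.

(** A constraint [a] on [x - c *: v] bounds c from above or below according to the sign of
    [pairing v a]. Eliminating c keeps the constraints nonnegative on v, because c >= 0, and adds
    for each pair of opposite signs the positive combination that vanishes on v. *)
Lemma fourier_motzkin (t : seq 'cV[R]_n) v : exists t' : seq 'cV[R]_n, forall x,
  (exists2 c, 0 <= c & forall a, a \in t -> 0 <= pairing (x - c *: v) a) <->
  (forall a, a \in t' -> 0 <= pairing x a).
Proof.
exists ([seq a <- t | 0 <= pairing v a] ++
  [seq pairing v p.1 *: p.2 - pairing v p.2 *: p.1 |
    p <- [seq (a, b) | a <- [seq a <- t | 0 < pairing v a], b <- [seq b <- t | pairing v b < 0]]]).
move=> x; split=> [[c c0 tc] a|tx].
  rewrite mem_cat => /orP[|/mapP[[a1 b] /allpairsP[[a2 b2] /=]]].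
    rewrite mem_filter => /andP[va /tc]; rewrite pairingBl pairingZl subr_ge0.
    by apply: le_trans; rewrite mulr_ge0.
  rewrite !mem_filter => -[/andP[va ta] /andP[vb tb]] [-> ->] -> /=.
  rewrite pairingBr !pairingZr.
  have := tc _ ta; have := tc _ tb; rewrite !pairingBl !pairingZl => Hb Ha.
  have := ler_wpM2l (ltW va) Hb.
  have nb : 0 <= - pairing v b2 by rewrite oppr_ge0 ltW.
  have := ler_wpM2l nb Ha; lra.
have [c [c0 Lc cE]] := attained_upper_bound
  [seq pairing x b / pairing v b | b <- t & pairing v b < 0].
exists c => // a ta; rewrite pairingBl pairingZl subr_ge0.
have [va|va|va] := ltgtP (pairing v a) 0.
- rewrite -ler_ndivrMr //; apply: Lc.
  by apply/mapP; exists a => //; rewrite mem_filter va.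
- case: cE => [->|/mapP[b]].
    by rewrite mul0r; apply: tx; rewrite mem_cat mem_filter ltW ?ta.
  rewrite mem_filter => /andP[vb tb] ->.
  have /tx : pairing v a *: b - pairing v b *: a \in
     [seq a <- t | 0 <= pairing v a] ++
  [seq pairing v p.1 *: p.2 - pairing v p.2 *: p.1 |
    p <- [seq (a, b) | a <- [seq a <- t | 0 < pairing v a], b <- [seq b <- t | pairing v b < 0]]].
    rewrite mem_cat; apply/orP; right; apply/mapP; exists (a, b) => //.
    by apply: allpairs_f; rewrite mem_filter ?va ?vb.
  rewrite pairingBr !pairingZr subr_ge0 mulrAC ler_ndivrMr //.
  by rewrite mulrC [X in _ <= X]mulrC.
- by rewrite va mulr0; apply: tx; rewrite mem_cat mem_filter va lexx ta.
Qed.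

Lemma cone_polyhedral s : exists t : seq 'cV[R]_n, forall x,
  cone s x <-> (forall a, a \in t -> 0 <= pairing x a).
Proof.
elim: s => [|v s [t IHt]] /=; last first.
  have [t' t'P] := fourier_motzkin t v; exists t' => x; rewrite -t'P.
  by split=> -[c c0 /IHt]; exists c.
exists ([seq delta_mx i 0 | i <- enum 'I_n] ++ [seq - delta_mx i 0 | i <- enum 'I_n]) => x.
have E i : pairing x (delta_mx i 0) = x 0 i.
  by rewrite /pairing -colE mxE.
split=> [-> a _|Hx]; first by rewrite /pairing mul0mx mxE.
apply/rowP => i; rewrite mxE; apply/eqP; rewrite eq_le -oppr_ge0.
have -> : - x 0 i = pairing x (- delta_mx i 0) by rewrite /pairing mulmxN mxE -/(pairing _ _) E.
have mem_f (f : 'I_n -> 'cV[R]_n) : f i \in [seq f j | j <- enum 'I_n].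
  by apply: map_f; rewrite mem_enum.
rewrite -E; apply/andP; split; apply: Hx; rewrite mem_cat.
  by rewrite (mem_f (fun i => - delta_mx i 0)) orbT.
by rewrite (mem_f (fun i => delta_mx i 0)).
Qed.

Lemma cone0 s : cone s 0.
Proof. by elim: s => //= v s IH; exists 0; rewrite // scale0r subr0. Qed.

Lemma coneD s x y : cone s x -> cone s y -> cone s (x + y).
Proof.
elim: s x y => [x y -> ->|v s IH x y [c c0 sx] [d d0 sy]] /=; first by rewrite addr0.
exists (c + d); first exact: addr_ge0.
by rewrite scalerDl opprD addrACA; apply: IH.
Qed.

Lemma coneZ s c x : 0 <= c -> cone s x -> cone s (c *: x).
Proof.
move=> c0; elim: s x => [x ->|v s IH x [d d0 sx]] /=; first by rewrite scaler0.
exists (c * d); first exact: mulr_ge0.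
by rewrite -scalerA -scalerBr; apply: IH.
Qed.

Lemma mem_cone s x : x \in s -> cone s x.
Proof.
elim: s => // v s IH; rewrite inE => /predU1P[->|/IH sx] /=.
  by exists 1; rewrite ?scale1r ?subrr //; apply: cone0.
by exists 0; rewrite // scale0r subr0.
Qed.

Lemma cone_sum s x : cone s x -> exists w : nat -> R, (forall i, 0 <= w i) /\
  x = \sum_(i < size s) w i *: nth 0 s i.
Proof.
elim: s x => [x -> |v s IH x [c c0 /IH[w [w0 xE]]]].
  by exists (fun=> 0); split=> //; rewrite big_ord0.
exists (fun i => if i is j.+1 then w j else c); split; first by case.
by rewrite big_ord_recl /= -xE addrC subrK.
Qed.

End Cone.

(** * Convex hulls of finite sets as intersections of half-spaces *)

Section AffineForms.
Context {R : realType} {n m : nat}.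
Implicit Types (N : 'M[R]_(n, m)) (b : 'rV[R]_m) (x y : 'rV[R]_n).

Definition aform N b x (i : 'I_m) : R := (x *m N + b) 0 i.

Lemma aform_line N b x y t i :
  aform N b (x + t *: (y - x)) i = aform N b x i + t * (aform N b y i - aform N b x i).
Proof.
by rewrite /aform mulmxDl -scalemxAl mulmxBl !mxE; ring.
Qed.

End AffineForms.

(** Homogenisation: x is in the hull exactly when (x, 1) is in the cone over the lifted points, the
    last coordinate forcing the weights to sum to 1. *)
Lemma convex_hull_polyhedral (R : realType) (n : nat) (S : set 'rV[R]_n) :
  finite_set S -> exists (m : nat) (N : 'M[R]_(n, m)) (b : 'rV[R]_m),
  convex_hull S = [set p | forall i, 0 <= aform N b p i].
Proof.
move=> /finite_seqP[s ->]; pose lft (c : R) (x : 'rV[R]_n) : 'rV[R]_(n + 1) := row_mx x c%:M.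
have lft_sum m (w : 'I_m -> R) (p : 'I_m -> 'rV[R]_n) :
    \sum_i w i *: lft 1 (p i) = lft (\sum_i w i) (\sum_i w i *: p i).
  elim: m w p => [|m IH] w p.
    by rewrite !big_ord0 /lft raddf0 row_mx0.
  by rewrite !big_ord_recl IH /lft scale_row_mx add_row_mx scale_scalar_mx mulr1 -raddfD.
have [t tP] := cone_polyhedral [seq lft 1 x | x <- s].
exists (size t), (\matrix_(i, j) (nth 0 t j) (lshift 1 i) 0), (\row_j (nth 0 t j) (rshift n 0) 0).
have pE p (j : 'I_(size t)) : aform (\matrix_(i, j) (nth 0 t j) (lshift 1 i) 0)
   (\row_j (nth 0 t j) (rshift n 0) 0) p j = pairing (lft 1 p) (nth 0 t j).
  rewrite /aform /pairing !mxE big_split_ord /= big_ord1.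
  rewrite /lft; congr (_ + _); last by rewrite row_mxEr !mxE mul1r.
  by apply: eq_bigr => i _; rewrite row_mxEl !mxE.
apply/seteqP; split=> [x [m [p [w [sp w0 w1 ->]]]] j|x Hx].
  rewrite pE; apply: (tP _).1 (mem_nth _ (ltn_ord j)).
  have -> : lft 1 (\sum_i w i *: p i) = \sum_i w i *: lft 1 (p i) by rewrite lft_sum w1.
  elim/big_ind: _ => [|y z|i _]; first exact: cone0.
    exact: coneD.
  by apply: coneZ => //; apply/mem_cone/map_f/sp.
have /tP/cone_sum[w [w0]] : forall a, a \in t -> 0 <= pairing (lft 1 x) a.
  move=> a ta; have at' : (index a t < size t)%N by rewrite index_mem.
  by have := Hx (Ordinal at'); rewrite pE /= nth_index.
rewrite size_map.
under eq_bigr => i _ do rewrite (nth_map 0) //.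
rewrite (lft_sum _ (fun i => w i) (fun i => nth 0 s i)) => /eq_row_mx[xE wE].
exists (size s), (fun i => nth 0 s i), (fun i => w i); split=> //.
  by move=> i; apply: mem_nth.
by move/matrixP: wE => /(_ 0 0); rewrite !mxE.
Qed.

(** * Affine spans *)

Section AffineSpan.
Context {R : realType} {n : nat}.
Implicit Types (X : set 'rV[R]_n) (x y : 'rV[R]_n).

Lemma sub_affine_span X : X `<=` affine_span X.
Proof.
move=> x Xx; exists 1%N, (fun=> x), (fun=> 1); split=> //.
  by rewrite big_ord1.
by rewrite big_ord1 scale1r.
Qed.

Lemma affine_span_line X x y t : X x -> X y -> affine_span X (x + t *: (y - x)).
Proof.
move=> Xx Xy; exists 2%N, (fun i => if i == 0 then x else y), (fun i => if i == 0 then 1 - t else t).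
split=> [i||]; first by case: ifP.
  by rewrite big_ord_recl big_ord1 /= subrK.
by rewrite big_ord_recl big_ord1 /= scalerBr scalerBl scale1r addrAC addrA.
Qed.

Lemma affine_span_aform X m (N : 'M[R]_(n, m)) b i :
  (forall p, X p -> aform N b p i = 0) ->
  forall p, affine_span X p -> aform N b p i = 0.
Proof.
move=> X0 _ [k [p [w [Xp w1 ->]]]].
have E : aform N b (\sum_i w i *: p i) i = \sum_j w j * aform N b (p j) i.
  rewrite /aform mulmx_suml mxE summxE -[b 0 i]mul1r -w1 mulr_suml -big_split /=.
  by apply: eq_bigr => j _; rewrite -scalemxAl !mxE mulrDr.
by rewrite E big1 // => j _; rewrite X0 ?mulr0.
Qed.

Lemma full_dim_affine_span X : has_dim X n -> affine_span X = setT.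
Proof.
move=> [x0 [V [-> dimV]]]; apply/seteqP; split=> // x _ /=.
suff -> : V = fullv by rewrite memvf.
by apply/eqP; rewrite eqEdim subvf dimvf dimV /= /dim /= mul1n.
Qed.

(** Seen from a point x of X, either direction space consists of the v with [v + x] in the affine
    span. *)
Lemma has_dim_uniq X k l : has_dim X k -> has_dim X l -> X !=set0 -> k = l.
Proof.
move=> [x0 [V [XV <-]]] [y0 [W [XW <-]]] [x Xx].
have := sub_affine_span Xx; rewrite XV /= => xx0.
have := sub_affine_span Xx; rewrite XW /= => xy0.
congr (\dim _); apply/vspaceP => v.
have E (U : {vspace 'rV[R]_n}) z : x - z \in U -> (v \in U) = (v + x - z \in U).
  move=> xz; rewrite -addrA; apply/idP/idP => [vU|vU]; first exact: memvD.
  by rewrite -[v](addrK (x - z)) memvB.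
rewrite (E V x0) // (E W y0) //.
have : affine_span X (v + x) <-> affine_span X (v + x) by [].
rewrite {1}XV XW /= => H.
by apply/idP/idP => /H.
Qed.

Lemma kernel_vspace k (A : 'M[R]_(n, k)) : exists V : {vspace 'rV[R]_n},
  (forall v, (v \in V) <-> v *m A = 0) /\ \dim V = (n - \rank A)%N.
Proof.
pose B := row_base (kermx A).
pose X := [tuple row i B | i < \rank (kermx A)].
have XE (i : 'I_(\rank (kermx A))) : X`_i = row i B by rewrite -tnth_nth tnth_mktuple.
have comb (c : 'I_(\rank (kermx A)) -> R) : \sum_i c i *: X`_i = (\row_i c i) *m B.
  by rewrite mulmx_sum_row; apply: eq_bigr => i _; rewrite XE mxE.
have freeX : free X.
  apply/freeP => c; rewrite comb => /eqP; rewrite -(mul0mx _ B).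
  move/eqP/(row_free_inj (row_base_free _))/rowP => H i.
  by have := H i; rewrite !mxE.
exists <<X>>%VS; split; last first.
  by have /eqP -> := freeX; rewrite size_tuple mxrank_ker.
move=> v; split.
  move/coord_span ->; rewrite comb; apply/sub_kermxP.
  by rewrite (submx_trans (submxMl _ _)) // eq_row_base.
move/sub_kermxP; rewrite -(eq_row_base (kermx A)) => /submxP[c ->].
rewrite mulmx_sum_row; apply: memv_suml => i _; apply: memvZ.
by rewrite -XE memv_span // mem_nth // size_tuple.
Qed.

End AffineSpan.

Lemma smooth_convex_coord (R : realType) (n : nat) (c : R) (j : 'I_n) :
  smooth_convex (fun x : 'rV[R]_n => c * x 0 j).
Proof.
have @f : {linear 'rV[R]_n -> R}.
  by exists (fun x : 'rV[R]_n => x 0 j); do 2![eexists]; do ?[constructor];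
     rewrite ?mxE// => ? *; rewrite ?mxE//; move=> ?; rewrite !mxE.
apply: (@smooth_convex_lin _ _ (c \*: f)) => x.
apply: (@continuousZl_tmp _ _ _ f c x); exact: coord_continuous.
Qed.

Section AformSmooth.
Context {R : realType} {n m : nat}.
Implicit Types (N : 'M[R]_(n, m)) (b : 'rV[R]_m).

Lemma smooth_convex_aform N b i : smooth_convex (fun x => aform N b x i).
Proof.
have -> : (fun x => aform N b x i) = ((fun x : 'rV[R]_n => \sum_j N j i * x 0 j) + cst (b 0 i)).
  apply/funext => x; rewrite /aform !mxE; congr (_ + _).
  by apply: eq_bigr => j _; rewrite mulrC.
apply: smooth_convexD; last exact: smooth_convex_cst.
by apply: smooth_convex_sum => j _; apply: smooth_convex_coord.
Qed.

Lemma aformN N b x i : aform (- N) (- b) x i = - aform N b x i.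
Proof. by rewrite /aform mulmxN -opprD mxE. Qed.

Lemma smooth_convex_aformN N b i : smooth_convex (fun x => - aform N b x i).
Proof.
under eq_fun do rewrite -aformN; exact: smooth_convex_aform.
Qed.

Lemma aform_continuous N b i : continuous (fun x => aform N b x i).
Proof. exact: ((smooth_convex_aform N b i).1 0). Qed.

End AformSmooth.

(** * Faces of a polyhedron and their relative interiors *)

Section Polyhedron.
Context {R : realType} {n m : nat} (N : 'M[R]_(n, m)) (b : 'rV[R]_m).
Implicit Types (C D F : set 'rV[R]_n) (x y v : 'rV[R]_n).

Definition polyhedron : set 'rV[R]_n := [set p | forall i, 0 <= aform N b p i].

Local Notation D := polyhedron.
Local Notation a := (aform N b).

Lemma aformD x v i : a (x + v) i = a x i + (v *m N) 0 i.
Proof. by rewrite /aform mulmxDl !mxE addrAC. Qed.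

Lemma aformDZ x t v i : a (x + t *: v) i = a x i + t * (v *m N) 0 i.
Proof. by rewrite aformD -scalemxAl mxE. Qed.

Lemma mulmx_aform x y i : ((y - x) *m N) 0 i = a y i - a x i.
Proof. by rewrite /aform mulmxBl !mxE; ring. Qed.

Lemma aform_gt0_near x : \forall y \near x, forall i, 0 < a x i -> 0 < a y i.
Proof.
apply: (@filter_forall _ _ (fun i y => 0 < a x i -> 0 < a y i)
  (nbhs x) (nbhs_filter x)) => i.
have [xi|xi] := ltP 0 (a x i).
  near=> y => _; near: y.
  exact: (@aform_continuous _ _ _ N b i x _ (lt_nbhsr xi)).
by near=> y.
Unshelve. all: end_near. Qed.

Lemma nbhs_line x v (W : set 'rV[R]_n) : nbhs x W -> exists2 t : R, 0 < t & W (x + t *: v).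
Proof.
move=> xW; have cv : x + t *: v @[t --> (0 : R)] --> x.
  rewrite [X in _ --> X](_ : x = x + 0 *: v); last by rewrite scale0r addr0.
  by apply: cvgD; [exact: cvg_cst|apply: cvgZr_tmp; exact: cvg_id].
have /filter_ex[t [t0 Wt]] : \forall t \near (0 : R)^'+, 0 < t /\ W (x + t *: v).
  near=> t; split; near: t; first exact: nbhs_right_gt.
  by apply: cvg_within; exact: cv.
by exists t.
Unshelve. all: end_near. Qed.

(** Active constraints are constant along v, and the others stay positive for a short time. *)
Lemma polyhedron_feasible x v : D x -> (forall i, a x i = 0 -> (v *m N) 0 i = 0) ->
  exists2 t : R, 0 < t & D (x + t *: v).
Proof.
move=> Dx v0; have [t t0 Ht] := nbhs_line v (aform_gt0_near x).
exists t => // i; have := Dx i; rewrite le_eqVlt => /predU1P[/esym xi|/Ht/ltW //].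
by rewrite aformDZ xi v0 // mulr0 addr0.
Qed.

(* For a face [F], these are exactly the points of [rel_int F]. *)
Definition generic_point F x := F x /\ forall i, a x i = 0 -> forall p, F p -> a p i = 0.

(** If p in D vanishes on the constraints active at x, a short step from x away from p stays in D.
    The functional [L] is minimal at x, hence cannot decrease on that step, which forces its value
    at p to be minimal too. *)
Lemma generic_face_eq F x : face D F -> generic_point F x ->
  F = [set p | D p /\ forall i, a x i = 0 -> a p i = 0].
Proof.
move=> [_ [L [l [Ll FE]]]] [Fx gx]; apply/seteqP; split=> p.
  by move=> Fp; split=> [|i xi]; [move: Fp; rewrite FE => -[]|exact: gx].
move=> [Dp p0]; have := Fx; rewrite FE => -[Dx /= Lx].
have [|t t0 /Ll] := @polyhedron_feasible x (x - p) Dx.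
  by move=> i xi; rewrite mulmx_aform xi p0 // subrr.
rewrite linearD linearZ linearB /= Lx -lerBlDl subrr pmulr_rge0 // subr_ge0 => Lp.
by split=> //=; apply/eqP; rewrite eq_le Lp Ll.
Qed.

(** The segment from p in F to x can be prolonged inside F. A constraint that is zero at x and
    nonnegative at both ends must vanish at p. *)
Lemma rel_int_generic F x : face D F -> rel_int F x -> generic_point F x.
Proof.
move=> [_ [L [l [Ll FE]]]] [Fx xF]; split=> // i xi p Fp.
have [t t0 Ht] := nbhs_line (x - p) xF.
have Fxt : F (x + t *: (x - p)).
  apply: Ht; have -> : t *: (x - p) = (- t) *: (p - x) by rewrite scaleNr -scalerN opprB.
  exact: affine_span_line.
have Dp : D p by move: Fp; rewrite FE => -[].
have : D (x + t *: (x - p)) by move: Fxt; rewrite FE => -[].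
move=> /(_ i); rewrite aformDZ mulmx_aform xi add0r sub0r pmulr_rge0 // oppr_ge0 => pi.
by apply/eqP; rewrite eq_le pi Dp.
Qed.

Lemma generic_rel_int F x : face D F -> generic_point F x -> rel_int F x.
Proof.
move=> fF gx; have [Fx gx0] := gx; have FE' := generic_face_eq fF gx.
split=> //; have Dx : D x by move: Fx; rewrite FE' => -[].
rewrite /within /=; near=> y => Fy; rewrite FE'.
have y0 i : a x i = 0 -> a y i = 0.
  by move=> xi; apply: affine_span_aform Fy; exact: gx0.
split=> // i; have := Dx i; rewrite le_eqVlt => /predU1P[/esym/y0 -> //|xi].
by apply: ltW; move: xi; move: i; near: y; exact: aform_gt0_near.
Unshelve. all: end_near. Qed.

(** Conversely, a short step from x towards such a y ends in F, and y is on the line through x and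
    that endpoint. *)
Lemma generic_affine_span F x : face D F -> generic_point F x ->
  affine_span F = [set y | forall i, a x i = 0 -> a y i = 0].
Proof.
move=> fF gx; have [Fx gx0] := gx; have FE' := generic_face_eq fF gx.
apply/seteqP; split=> [y Fy i xi|y /= y0].
  by apply: affine_span_aform Fy; exact: gx0.
have Dx : D x by move: Fx; rewrite FE' => -[].
have [|t t0 Dt] := @polyhedron_feasible x (y - x) Dx.
  by move=> i xi; rewrite mulmx_aform xi y0 // subrr.
have Ft : F (x + t *: (y - x)).
  rewrite FE'; split=> // i xi; rewrite aformDZ mulmx_aform xi y0 // subrr mulr0 addr0 //.
have := affine_span_line t^-1 Fx Ft.
by rewrite [x + t *: _]addrC addrK scalerA mulVf ?gt_eqF // scale1r addrC subrK.
Qed.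

Definition active x : {set 'I_m} := [set i | a x i == 0].

Definition active_mx (J : {set 'I_m}) : 'M[R]_(n, #|J|) := colsub (fun k : 'I_#|J| => enum_val k) N.

Lemma active_mx0 v J : v *m active_mx J = 0 <-> forall i, i \in J -> (v *m N) 0 i = 0.
Proof.
have E k : (v *m active_mx J) 0 k = (v *m N) 0 (enum_val k).
  by rewrite !mxE; apply: eq_bigr => j _; rewrite !mxE.
split=> [/rowP H i iJ|H]; last by apply/rowP => k; rewrite E H ?enum_valP // [RHS]mxE.
by have := H (enum_rank_in iJ i); rewrite E enum_rankK_in // => ->; rewrite mxE.
Qed.

Lemma generic_has_dim F x : face D F -> generic_point F x ->
  has_dim F (n - \rank (active_mx (active x))).
Proof.
move=> fF gx; have [V [VP dimV]] := kernel_vspace (active_mx (active x)).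
exists x, V; split=> //; rewrite (generic_affine_span fF gx).
apply/seteqP; split=> y /=.
  move=> y0; apply/VP/active_mx0 => i; rewrite inE => /eqP xi.
  by rewrite mulmx_aform xi y0 // subrr.
move=> /VP/active_mx0 H i xi.
by have := H i; rewrite inE xi eqxx mulmx_aform xi subr0; apply.
Qed.

(** Treat the constraints in turn: if one is positive somewhere on F, move to the midpoint with such
    a point. Midpoints keep every positivity gained earlier. *)
Lemma generic_exists F : face D F -> (forall p q, F p -> F q -> F (p + 2^-1 *: (q - p))) ->
  exists x, generic_point F x.
Proof.
move=> fF Fmid; have [F0 [L [l [Ll FE]]]] := fF.
have FD p : F p -> D p by rewrite FE => -[].
suff: forall r : seq 'I_m, exists2 x, F x & forall i, i \in r -> a x i = 0 -> forall p, F p -> a p i = 0.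
  move=> /(_ (enum 'I_m))[x Fx gx]; exists x; split=> // i; apply: gx.
  by rewrite mem_enum.
elim=> [|i r [x Fx gx]]; first by have [x Fx] := F0; exists x.
have [Fi|/existsNP[p /not_implyP[Fp /eqP pi]]] := pselect (forall p, F p -> a p i = 0).
  by exists x => // j; rewrite inE => /predU1P[-> _ //|/gx].
have {}pi : 0 < a p i by rewrite lt_def pi FD.
exists (x + 2^-1 *: (p - x)); first exact: Fmid.
move=> j; rewrite inE aform_line => /predU1P[->|jr] E.
  by have := FD _ Fx i; lra.
apply: gx => //; have := FD _ Fx j; have := FD _ Fp j; lra.
Qed.

End Polyhedron.

(** * Irredundant representations and simple polytopes *)

Definition functional (R : realType) (n : nat) (a : 'cV[R]_n) (x : 'rV[R]_n) : R := pairing x a.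

Lemma functional_linear (R : realType) (n : nat) (a : 'cV[R]_n) : scalar (functional a).
Proof. by move=> c x y; rewrite /functional pairingDl pairingZl. Qed.

HB.instance Definition _ (R : realType) (n : nat) (a : 'cV[R]_n) :=
  GRing.isLinear.Build R 'rV[R]_n R *%R (functional a) (functional_linear a).

(** An interior point, and for each constraint a point where it alone is active; the latter makes
    the walls pairwise distinct facets. *)
Definition irredundant (R : realType) (n m : nat) (N : 'M[R]_(n, m)) (b : 'rV[R]_m) :=
  (exists q, forall i, 0 < aform N b q i) /\
  forall i, exists2 z, aform N b z i = 0 & forall j, j != i -> 0 < aform N b z j.

Lemma polyhedron_midpoint (R : realType) (n m : nat) (N : 'M[R]_(n, m)) b p q :
  polyhedron N b p -> polyhedron N b q -> polyhedron N b (p + 2^-1 *: (q - p)).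
Proof.
by move=> Dp Dq i; rewrite aform_line; have := Dp i; have := Dq i; lra.
Qed.

Lemma face_midpoint (R : realType) (n m : nat) (N : 'M[R]_(n, m)) b F p q :
  face (polyhedron N b) F -> F p -> F q -> F (p + 2^-1 *: (q - p)).
Proof.
move=> [_ [L [l [_ ->]]]] [Dp /= Lp] [Dq /= Lq]; split=> /=.
  exact: polyhedron_midpoint.
by rewrite linearD linearZ linearB /= Lp Lq subrr mulr0 addr0.
Qed.

Lemma face_self (R : realType) (n : nat) (D : set 'rV[R]_n) : D !=set0 -> face D D.
Proof.
move=> D0; split=> //; exists (functional 0 : {scalar 'rV[R]_n}), 0.
have E x : functional (0 : 'cV[R]_n) x = 0 by rewrite /functional /pairing mulmx0 mxE.
split=> [x _|]; first by rewrite /= E.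
by apply/seteqP; split=> [x Dx|x []] //; split=> //=.
Qed.

(* A representation with the fewest constraints is irredundant. *)
Lemma irredundant_representation (R : realType) (n : nat) (D : set 'rV[R]_n) :
  polytope D -> has_dim D n ->
  exists m (N : 'M[R]_(n, m)) b, D = polyhedron N b /\ irredundant N b.
Proof.
move=> [S [finS DS]] dimD.
pose P m := `[< exists (N : 'M[R]_(n, m)) b, D = polyhedron N b >].
have exP : exists m, P m.
  have [m [N [b E]]] := convex_hull_polyhedral finS.
  by exists m; apply/asboolP; exists N, b; rewrite DS.
case: (ex_minnP exP) => m /asboolP[N [b DE]] m_min; exists m, N, b; split=> //.
(* By minimality, dropping constraint i enlarges the polyhedron, so some point violates this
   constraint only. *)
have nonred i : exists2 p, aform N b p i < 0 & forall j, j != i -> 0 <= aform N b p j.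
  apply: contrapT => H; have : P m.-1.
    apply/asboolP; exists (col' i N), (col' i b); rewrite DE; apply/seteqP; split=> p Dp.
      move=> k; have := Dp (lift i k); congr (0 <= _).
      by rewrite /aform !mxE; congr (_ + _); apply: eq_bigr => j _; rewrite !mxE.
    have Dp' j : j != i -> 0 <= aform N b p j.
      rewrite eq_sym => /unlift_some[k -> _]; have := Dp k; congr (0 <= _).
      by rewrite /aform !mxE; congr (_ + _); apply: eq_bigr => j' _; rewrite !mxE.
    move=> j; have [->|] := eqVneq j i; last exact: Dp'.
    by rewrite leNgt; apply/negP => pi; apply: H; exists p.
  by move/m_min; rewrite leqNgt prednK ?leqnn // (leq_ltn_trans _ (ltn_ord i)).
have aff := full_dim_affine_span dimD.
have D0 : D !=set0.
  have [x0 [V [E _]]] := dimD; have : affine_span D x0 by rewrite aff.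
  move=> [[|k] [p [w [Dp w1 _]]]]; last by exists (p 0).
  by move: w1; rewrite big_ord0 => /esym/eqP; rewrite oner_eq0.
have fD : face (polyhedron N b) D by rewrite -DE; apply: face_self.
have [q gq] := generic_exists fD (fun p r Fp Fr => face_midpoint fD Fp Fr).
have [Dq gq0] := gq.
(* A constraint vanishing at the generic point q would vanish on D, hence on its affine span, the
   whole space, yet it is negative at p. *)
have q0 i : 0 < aform N b q i.
  rewrite lt_def; move: Dq; rewrite DE => -> ; rewrite andbT; apply/eqP => qi.
  have [p pi _] := nonred i.
  have : affine_span D p by rewrite aff.
  by move/(affine_span_aform (gq0 i qi)) => p0; rewrite p0 ltxx in pi.
split; first by exists q.
move=> i; have [p pi pj] := nonred i; have qi := q0 i.
(* The parameter at which the segment from q to p crosses the i-th hyperplane. *)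
pose t := aform N b q i / (aform N b q i - aform N b p i).
have den : 0 < aform N b q i - aform N b p i by lra.
exists (q + t *: (p - q)).
  by rewrite aform_line /t; field; rewrite gt_eqF.
move=> j ji; rewrite aform_line.
have t0 : 0 < t by rewrite divr_gt0.
have t1 : t < 1 by rewrite ltr_pdivrMr // mul1r; lra.
have := mulr_ge0 (ltW t0) (pj j ji); have : 0 < (1 - t) * aform N b q j by rewrite mulr_gt0 // subr_gt0.
by lra.
Qed.

Section Simple.
Context {R : realType} {n m : nat} (N : 'M[R]_(n, m)) (b : 'rV[R]_m).
Hypothesis irr : irredundant N b.
Local Notation D := (polyhedron N b).
Local Notation a := (aform N b).

Definition wall i : set 'rV[R]_n := D `&` [set p | a p i = 0].

Lemma face_wall i : face D (wall i).
Proof.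
have [z zi zj] := irr.2 i.
have Dz : D z by move=> j; have [->|/zj/ltW //] := eqVneq j i; rewrite zi.
have E p : a p i = functional (col i N) p + b 0 i.
  rewrite /functional /aform /pairing !mxE; congr (_ + _).
  by apply: eq_bigr => k _; rewrite mxE.
split; first by exists z; split.
exists (functional (col i N) : {scalar 'rV[R]_n}), (- b 0 i); split=> [x Dx|].
  by have := Dx i; rewrite E /= -lerBlDr sub0r.
apply/seteqP; split=> p [Dp /= pi]; split=> //=.
  by rewrite E in pi; apply/eqP; rewrite -subr_eq0 opprK pi.
by rewrite E pi addNr.
Qed.

Lemma wall_inj : injective wall.
Proof.
move=> i j wij; have [z zi zj] := irr.2 i.
have : wall i z.
  by split=> // k; have [->|/zj/ltW //] := eqVneq k i; rewrite zi.
rewrite wij => -[_ /= aj]; apply/eqP; rewrite eq_sym; apply: contraT => /zj.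
by rewrite aj ltxx.
Qed.

Lemma full_dim_codim d : has_dim D n -> (d <= n)%N -> has_dim D ((n - d) + d).
Proof. by move=> dimD dn; rewrite subnK. Qed.

(** The point where only constraint i is active is generic, so the codimension is the rank of one
    column, nonzero because the form is positive at an interior point. *)
Lemma facet_wall i : has_dim D n -> facet D (wall i).
Proof.
move=> dimD; have [z zi zj] := irr.2 i; have fw := face_wall i.
have gz : generic_point N b (wall i) z.
  split; first by split=> // k; have [->|/zj/ltW //] := eqVneq k i; rewrite zi.
  move=> j aj p [_ /= pi]; have [->//|/zj] := eqVneq j i.
  by rewrite aj ltxx.
have act : active N b z = [set i]%SET.
  apply/setP => j; rewrite !inE; have [->|/zj zj0] := eqVneq j i; first by rewrite zi eqxx.
  by rewrite gt_eqF.
have r1 : \rank (active_mx N (active N b z)) = 1%N.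
  apply/eqP; rewrite eqn_leq (leq_trans (rank_leq_col _)) ?act ?cards1 //=.
  rewrite lt0n mxrank_eq0; apply/eqP => A0; have [q q0] := irr.1.
  have /active_mx0/(_ i) : (q - z) *m active_mx N [set i]%SET = 0 by rewrite A0 mulmx0.
  rewrite inE eqxx => /(_ isT); rewrite (mulmx_aform N b) zi subr0 => qi.
  by have := q0 i; rewrite qi ltxx.
have n1 : (1 <= n)%N by rewrite -r1 rank_leq_row.
split=> //; exists (n - 1)%N; rewrite -{1}r1; split; first exact: generic_has_dim.
exact: full_dim_codim.
Qed.

(* The walls of the active constraints are distinct facets containing [F], and
   simplicity allows at most codim F = rank of them. *)
Lemma simple_active_rank F x : simple_polytope D -> has_dim D n -> face D F ->
  generic_point N b F x -> \rank (active_mx N (active N b x)) = #|active N b x|.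
Proof.
move=> [_ simpleD] dimD fF gx; apply/eqP; rewrite eqn_leq rank_leq_col /=.
set J := active N b x; set r := \rank _.
have cF : face_of_codim D r F.
  split=> //; exists (n - r)%N; split; first exact: generic_has_dim.
  by apply: full_dim_codim => //; apply: rank_leq_row.
have := simpleD _ _ cF; set A := [set G | _] => Ar.
pose g (k : 'I_#|J|) := wall (enum_val k).
have g_inj : {in setT &, injective g}.
  by move=> k l _ _ /wall_inj/enum_val_inj.
rewrite -card_le_II; apply: card_le_trans Ar.
rewrite (card_le_eql card_II) -(card_le_eql (inj_card_eq g_inj)).
apply: subset_card_le => _ [k _ <-]; split; first exact: facet_wall.
move=> p Fp; split.
  by move: Fp; have [_ [L [l [_ ->]]]] := fF => -[].
by apply: gx.2 => //; apply/eqP; have := enum_valP k; rewrite inE.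
Qed.

End Simple.

(** * Coordinates adapted to a face *)

(** The first l columns form a basis of a complement of the column space of A. *)
Lemma complete_columns (R : realType) (n l k : nat) (A : 'M[R]_(n, k)) :
  n = (l + k)%N -> \rank A = k ->
  exists2 B : 'M[R]_n, B \in unitmx &
    forall (j : 'I_k) (i : 'I_n), i = (l + j)%N :> nat -> col i B = col j A.
Proof.
move=> e; subst n => rA; pose C := row_base (A^T)^C%MS.
have rC : \rank (A^T)^C%MS = l by rewrite mxrank_compl mxrank_tr rA addnK.
pose C' : 'M[R]_(l, l + k) := castmx (rC, erefl) C.
exists (col_mx C' A^T)^T.
  rewrite unitmx_tr -row_full_unit -sub1mx -addsmxE.
  have C'E : (C' :=: (A^T)^C)%MS.
    exact: eqmx_trans (eqmx_cast _ _) (eq_row_base _).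
  rewrite (adds_eqmx C'E (eqmx_refl _)) addsmxC sub1mx.
  exact: addsmx_compl_full.
move=> j i ij; have -> : i = rshift l j by apply: val_inj.
by apply/colP => r; rewrite !mxE (unsplitK (inr j)) !mxE.
Qed.

Lemma seq_small_enough (R : realType) (T : eqType) (s : seq T) (P : T -> R -> Prop) :
  (forall t, t \in s -> exists2 e, 0 < e & forall d, 0 < d <= e -> P t d) ->
  exists2 e, 0 < e & forall t, t \in s -> forall d, 0 < d <= e -> P t d.
Proof.
elim: s => [_|t s IH H]; first by exists 1.
have [|e e0 He] := IH; first by move=> u us; apply: H; rewrite inE us orbT.
have [f f0 Hf] := H t (mem_head _ _).
exists (Num.min e f); first by rewrite lt_min e0.
move=> u; rewrite inE => /predU1P[->|us] d; rewrite le_min => /and3P[d0 de df].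
  by apply: Hf; rewrite d0.
by apply: (He u us); rewrite d0.
Qed.

Lemma coord_box_small (R : realType) (n : nat) (A : 'M[R]_n) (x : 'rV[R]_n) (W : set 'rV[R]_n) :
  A \in unitmx -> nbhs x W ->
  exists2 e, 0 < e & forall p, (forall i, `|affine_coord A (- x *m A) p i| < e) -> W p.
Proof.
move=> uA /nbhs_ballP[r /= r0 rW].
pose M := \sum_i \sum_j `|invmx A i j|.
have M0 : 0 <= M by apply: sumr_ge0 => i _; apply: sumr_ge0.
(* The inverse matrix enlarges coordinates by a factor at most [M]; adding 1 avoids a zero
   denominator. *)
exists (r / (M + 1)); first by rewrite divr_gt0 // ltr_wpDl.
move=> p Hp; apply: rW.
have px : p - x = ((p - x) *m A) *m invmx A by rewrite mulmxK.
have cE i : affine_coord A (- x *m A) p i = ((p - x) *m A) 0 i.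
  by rewrite /affine_coord -mulmxDl.
have : forall j, `|x 0 j - p 0 j| < r.
  move=> j; have -> : x 0 j - p 0 j = - \sum_i ((p - x) *m A) 0 i * invmx A i j.
    by move/rowP: px => /(_ j); rewrite [RHS]mxE => <-; rewrite !mxE opprB.
  rewrite normrN (le_lt_trans (ler_norm_sum _ _ _)) //.
  apply: (@le_lt_trans _ _ (r / (M + 1) * M)).
    rewrite mulr_sumr; apply: ler_sum => i _; rewrite normrM.
    apply: ler_pM => //; first by rewrite -cE ltW.
    by rewrite (bigD1 j) //= lerDl sumr_ge0.
  by rewrite mulrAC ltr_pdivrMr ?ltr_wpDl // ltr_pM2l // ltrDl.
move=> H; split=> // i j; rewrite ord1; exact: H.
Qed.

Lemma affine_coordE (R : realType) (n : nat) (A : 'M[R]_n) x p i :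
  affine_coord A (- x *m A) p i = ((p - x) *m A) 0 i.
Proof. by rewrite /affine_coord -mulmxDl. Qed.

(** * Convex quadratic models of the faces *)

Lemma smooth_convex_normal_form (R : realType) (n l : nat) (A : 'M[R]_n) b :
  smooth_convex (fun p => normal_form l (affine_coord A b p)).
Proof.
rewrite (_ : (fun p => _) =
  (fun p => \sum_(i < n | (i < l)%N) ((fun p => aform A b p i) * (fun p => aform A b p i)) p) +
  (fun p => \sum_(i < n | (l <= i)%N) - aform A b p i)).
  apply: smooth_convexD; apply: smooth_convex_sum => i _.
    apply: smooth_convex_sqr; first exact: (smooth_convex_aform _ _ _).1.
      exact: smooth_convex_aform.
    exact: smooth_convex_aformN.
  exact: smooth_convex_aformN.
apply/funext => p; rewrite /normal_form /= -sumrN; congr (_ + _).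
Qed.

(** Property (C) at one point, with the extra demand that the box fit into [W]; [W] will be the set
    where the glued function equals the model. *)
Definition local_normal_form (R : realType) (n : nat) (D : set 'rV[R]_n) (x : 'rV[R]_n) l
    (f : 'rV[R]_n -> R) (W : set 'rV[R]_n) :=
  exists (e : R) (U : set 'rV[R]_n) (A : 'M[R]_n) (b : 'rV[R]_n),
      [/\ 0 < e,
          [/\ U `<=` D, U `<=` W & within D (nbhs x) U],
          A \in unitmx /\ (forall i, affine_coord A b x i = 0),
          U = [set p | coord_box l e (affine_coord A b p)]
        & exists r s : R, r != 0 /\
            forall p, U p -> f p = r * normal_form l (affine_coord A b p) + s].

Section Model.
Context {R : realType} {n m : nat} (N : 'M[R]_(n, m)) (b : 'rV[R]_m).
Hypothesis irr : irredundant N b.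
Local Notation D := (polyhedron N b).
Local Notation a := (aform N b).
Hypothesis simpleD : simple_polytope D.
Hypothesis dimD : has_dim D n.
Variables (F : set 'rV[R]_n) (x : 'rV[R]_n).
Hypothesis fF : face D F.
Hypothesis gx : generic_point N b F x.
Local Notation J := (active N b x).
Let l := (n - #|J|)%N.

(** Simplicity makes the active forms linearly independent, so they can serve as the last
    coordinates. *)
Lemma adapted_coordinates : exists B : 'M[R]_n, [/\ B \in unitmx,
    forall i : 'I_n, (l <= i)%N -> exists2 j, a x j = 0 & forall p, ((p - x) *m B) 0 i = a p j
  & forall j, a x j = 0 -> exists2 i : 'I_n, (l <= i)%N & forall p, ((p - x) *m B) 0 i = a p j].
Proof.
have rJ := simple_active_rank irr simpleD dimD fF gx.
have kn : (#|J| <= n)%N by rewrite -rJ rank_leq_row.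
have nE : n = (l + #|J|)%N by rewrite subnK.
have [B uB BJ] := complete_columns nE rJ.
have BE (k : 'I_#|J|) (i : 'I_n) : i = (l + k)%N :> nat -> forall p, ((p - x) *m B) 0 i = a p (enum_val k).
  move=> ik p; have := enum_valP k; rewrite inE => /eqP xk.
  rewrite -[RHS]subr0 -xk -mulmx_aform !mxE; apply: eq_bigr => r _; congr (_ * _).
  by have /colP/(_ r) := BJ k i ik; rewrite !mxE.
exists B; split=> // [i li|j xj].
  have ik : (i - l < #|J|)%N by rewrite ltn_subLR // -nE.
  exists (enum_val (Ordinal ik)).
    by have := enum_valP (Ordinal ik); rewrite inE => /eqP.
  by apply: BE; rewrite /= subnKC.
have jJ : j \in J by rewrite inE xj.
have il : (l + enum_rank_in jJ j < n)%N by rewrite [X in (_ < X)%N]nE ltn_add2l.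
exists (Ordinal il); first by rewrite /= leq_addr.
by move=> p; rewrite (BE (enum_rank_in jJ j)) // enum_rankK_in.
Qed.

(** The list [pts] will hold the chosen points of the other faces with their prescribed values,
    below which the model must stay. *)
Lemma face_model (al : R) (pts : seq ('rV[R]_n * R)) :
  (forall y, y \in pts -> D y.1 /\ (F y.1 -> al < y.2)) ->
  exists q : 'rV[R]_n -> R, [/\ smooth_convex q, q x = al,
    forall p, F p -> p <> x -> al < q p,
    forall y, y \in pts -> q y.1 < y.2
  & forall W, nbhs x W -> local_normal_form D x l q W].
Proof.
move=> Hpts; have [B [uB Bx Bj]] := adapted_coordinates.
have FE := generic_face_eq fF gx; have [Fx gx0] := gx.
have Dx : D x by move: Fx; rewrite FE => -[].
pose c (p : 'rV[R]_n) (i : 'I_n) : R := ((p - x) *m B) 0 i.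
pose Q (p : 'rV[R]_n) : R := \sum_(i < n | (i < l)%N) c p i ^+ 2.
pose S (p : 'rV[R]_n) : R := \sum_(i < n | (l <= i)%N) c p i.
have Q0 p : 0 <= Q p by apply: sumr_ge0 => i _; apply: sqr_ge0.
have c_ge0 p (i : 'I_n) : D p -> (l <= i)%N -> 0 <= c p i.
  by move=> Dp /Bx[j _ E]; rewrite /c E.
have S_eq0 p : F p -> S p = 0.
  move=> Fp; apply: big1 => i /Bx[j xj E]; rewrite /c E; exact: gx0.
have S_gt0 p : D p -> ~ F p -> 0 < S p.
  move=> Dp nFp; rewrite lt_def sumr_ge0 ?andbT; last by move=> i; apply: c_ge0.
  apply/eqP => /psumr_eq0P H; apply: nFp; rewrite FE; split=> // j /Bj[i li E].
  by rewrite -E; apply: H => // k; apply: c_ge0.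
have [d d0 Hd] : exists2 d, 0 < d & forall y, y \in pts -> F y.1 -> al + d * Q y.1 < y.2.
  have [t tp|e e0 He] := @seq_small_enough R _ pts (fun y d => F y.1 -> al + d * Q y.1 < y.2).
    have [nFt|Ft] := pselect (~ F t.1); first by exists 1.
    have {}Ft := contrapT Ft; have [_ /(_ Ft) at'] := Hpts t tp.
    have q1 : 0 < Q t.1 + 1 by rewrite ltr_wpDl.
    exists ((t.2 - al) / (Q t.1 + 1)); first by rewrite divr_gt0 // subr_gt0.
    move=> d /andP[d0]; rewrite ler_pdivlMr // mulrDr mulr1 => dq _; lra.
  by exists e => // y yp; apply: (He y yp); rewrite e0 lexx.
have [k k0 Hk] : exists2 k, 0 < k & forall y, y \in pts -> ~ F y.1 -> al + d * (Q y.1 - k * S y.1) < y.2.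
  (* The small parameter is the inverse of the large factor [k]. *)
  have [t tp|e e0 He] := @seq_small_enough R _ pts (fun y k => ~ F y.1 -> al + d * (Q y.1 - k^-1 * S y.1) < y.2).
    have [Ft|nFt] := pselect (F t.1); first by exists 1.
    have S0 := S_gt0 _ (Hpts t tp).1 nFt.
    pose K := Q t.1 + `|al - t.2| / d + 1.
    have K0 : 0 < K by rewrite ltr_wpDl // addr_ge0 // divr_ge0 // ltW.
    exists (S t.1 / K); first by rewrite divr_gt0.
    move=> k /andP[k0]; rewrite ler_pdivlMr // mulrC => kK _.
    have : K <= k^-1 * S t.1 by rewrite mulrC ler_pdivlMr.
    rewrite -(ler_pM2l d0) /K !mulrDr [d * (_ / d)]mulrCA divff ?gt_eqF // mulr1.
    have := ler_norm (al - t.2); rewrite mulrN; lra.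
  by exists e^-1; rewrite ?invr_gt0 // => y yp; apply: (He y yp); rewrite e0 lexx.
(* Scaling the y-coordinates by [k] absorbs this factor, so that the normal form has coefficients 1
   and -1. *)
pose w := \row_(i < n) (if (i < l)%N then 1 else k) : 'rV[R]_n.
pose A := B *m diag_mx w.
have uA : A \in unitmx.
  rewrite unitmx_mul uB unitmxE det_diag unitfE; apply/prodf_neq0 => i _.
  by rewrite mxE; case: ifP => _; rewrite ?oner_eq0 ?gt_eqF.
have cA p i : affine_coord A (- x *m A) p i = c p i * w 0 i.
  by rewrite affine_coordE /A mulmxA mul_mx_diag mxE.
have nfE p : normal_form l (affine_coord A (- x *m A) p) = Q p - k * S p.
  rewrite /normal_form mulr_sumr; congr (_ - _); apply: eq_bigr => i li; rewrite cA mxE.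
    by rewrite li mulr1.
  by rewrite ltnNge li /= mulrC.
have cAx i : affine_coord A (- x *m A) x i = 0 by rewrite cA /c subrr mul0mx mxE mul0r.
exists (cst al + d *: (fun p => normal_form l (affine_coord A (- x *m A) p))).
have qE p : (cst al + d *: (fun p => normal_form l (affine_coord A (- x *m A) p))) p = al + d * (Q p - k * S p).
  by rewrite -nfE.
split.
- apply: smooth_convexD; first exact: smooth_convex_cst.
  by apply: smooth_convexZ; [exact: ltW|exact: smooth_convex_normal_form].
- rewrite qE S_eq0 // /Q big1 ?mulr0 ?subr0 ?mulr0 ?addr0 // => i _.
  by rewrite /c subrr mul0mx mxE expr0n.
- move=> p Fp px; rewrite qE S_eq0 // mulr0 subr0 ltrDl mulr_gt0 // lt_def Q0 andbT.
  apply/eqP => /psumr_eq0P H; apply: px; apply/eqP; rewrite -subr_eq0.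
  rewrite -[p - x](mulmxK uB) (_ : (p - x) *m B = 0) ?mul0mx //.
  apply/rowP => i; rewrite [RHS]mxE; have [il|li] := ltnP i l.
    by apply/eqP; rewrite -sqrf_eq0; apply/eqP/H => // j _; apply: sqr_ge0.
  by have [j xj ->] := Bx i li; apply: gx0.
- move=> y yp; rewrite qE; have [Fy|nFy] := pselect (F y.1); last exact: Hk.
  by rewrite S_eq0 // mulr0 subr0; apply: Hd.
move=> W xW.
(* The box is also taken where the inactive constraints remain positive; the active ones are
   nonnegative through the y-coordinates, so the box lies in D. *)
have [e e0 He] := coord_box_small uA (filterI xW (aform_gt0_near N b x)).
have w0 i : 0 < w 0 i by rewrite mxE; case: ifP.
have boxW p : coord_box l e (affine_coord A (- x *m A) p) -> W p /\ forall i, 0 < a x i -> 0 < a p i.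
  move=> Hp; apply: He => i; have := Hp i; case: ifP => _; first by rewrite ltr_norml.
  by move=> /andP[p0 pe]; rewrite ger0_norm.
exists e, [set p | coord_box l e (affine_coord A (- x *m A) p)], A, (- x *m A); split=> //.
- split=> [p Hp j|p /boxW[]//|].
    have [_ Hgt] := boxW p Hp.
    have := Dx j; rewrite le_eqVlt => /predU1P[/esym/Bj[i li E]|/Hgt/ltW //].
    rewrite -E; have := Hp i; rewrite ltnNge li /= => /andP[].
    by rewrite cA pmulr_lge0.
  rewrite /within /=.
  have near_small : \forall p \near x, forall i, `|affine_coord A (- x *m A) p i| < e.
    apply: (@filter_forall _ _ (fun i p => `|affine_coord A (- x *m A) p i| < e) (nbhs x) (nbhs_filter x)) => i.
    have : affine_coord A (- x *m A) p i @[p --> x] --> affine_coord A (- x *m A) x i.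
      exact: (@aform_continuous _ _ _ A (- x *m A) i x).
    by rewrite cAx => /cvgr0Pnorm_lt; apply.
  apply: filterS near_small => p Hp Dp i; have := Hp i; rewrite ltr_norml => /andP[p1 p2].
  case: ifP => il; first by rewrite p1.
  by rewrite p2 andbT cA mulr_ge0 ?(ltW (w0 i)) // c_ge0 // leqNgt il.
- exists d, al; split; first by rewrite gt_eqF.
  by move=> p _; rewrite addrC.
Qed.

End Model.

(** * Gluing the models of the faces *)

Lemma cdiff_C_k (R : realType) (n k : nat) (U : set 'rV[R]_n) (g : 'rV[R]_n -> R) :
  cdiff k g -> C_k k U g.
Proof.
elim: k g => [|k IHk] g; first by move=> cg x _; apply: cg.
by move=> [dg Dg]; split=> [x _|v]; [apply: dg|apply/IHk/Dg].
Qed.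

Lemma near_seq (T : eqType) (U : Type) (s : seq T) (P : T -> U -> Prop) (F : set_system U) :
  Filter F -> (forall t, t \in s -> \forall x \near F, P t x) ->
  \forall x \near F, forall t, t \in s -> P t x.
Proof.
move=> FF; elim: s => [_|t s IH H]; first by apply: filterE.
have Hs : forall u, u \in s -> \forall x \near F, P u x.
  by move=> u us; apply: H; rewrite inE us orbT.
apply: filterS2 (H t (mem_head _ _)) (IH Hs) => x Pt Ps u.
by rewrite inE => /predU1P[->|/Ps].
Qed.

Section Assembly.
Context {R : realType} {n m : nat} (N : 'M[R]_(n, m)) (b : 'rV[R]_m).
Hypothesis irr : irredundant N b.
Local Notation D := (polyhedron N b).
Local Notation a := (aform N b).
Hypothesis simpleD : simple_polytope D.
Hypothesis dimD : has_dim D n.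

Lemma generic_subface F x G y : face D F -> generic_point N b F x -> face D G ->
  generic_point N b G y -> F y -> G `<=` F.
Proof.
move=> fF gx fG gy; rewrite (generic_face_eq fF gx) => -[Dy y0] p Gp; split.
  by move: Gp; rewrite (generic_face_eq fG gy) => -[].
by move=> i /y0 /gy.2; apply.
Qed.

(** A face is recovered from the set of constraints active at its generic point. *)
Lemma finite_faces (xF : set 'rV[R]_n -> 'rV[R]_n) :
  (forall F, face D F -> generic_point N b F (xF F)) -> finite_set (face D).
Proof.
move=> gF.
pose g (J : {set 'I_m}) := [set p | D p /\ forall i, i \in J -> a p i = 0].
apply: (@sub_finite_set _ _ (g @` [set: {set 'I_m}])); last exact: finite_image.
move=> F fF; exists (active N b (xF F)) => //.
rewrite [RHS](generic_face_eq fF (gF F fF)); apply/seteqP; split=> p [Dp p0]; split=> // i.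
  by move=> xi; apply: p0; rewrite inE xi.
by rewrite inE => /eqP; apply: p0.
Qed.

Lemma prescribed_function (xF : set 'rV[R]_n -> 'rV[R]_n) (alpha : set 'rV[R]_n -> R) :
  face_data D xF alpha ->
  exists f : 'rV[R]_n -> R,
    [/\ smooth_on D f, property_A D f, property_B D xF alpha f & property_C D xF f].
Proof.
move=> [riF _ alpha_lt].
have gF F : face D F -> generic_point N b F (xF F).
  by move=> fF; apply: rel_int_generic => //; apply: riF.
have /finite_seqP[s0 s0E] := finite_faces gF.
pose s := undup s0.
have sP F : F \in s <-> face D F.
  rewrite mem_undup; have : face D F <-> [set` s0] F by rewrite s0E.
  by move=> H; split=> [Fs|/H //]; apply/H.
have subD F p : face D F -> F p -> D p by move=> [_ [L [l [_ ->]]]] [].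
have /choice[q qP] F : exists q : 'rV[R]_n -> R, face D F -> [/\ smooth_convex q, q (xF F) = alpha F,
    forall p, F p -> p <> xF F -> alpha F < q p,
    forall G, face D G -> G != F -> q (xF G) < alpha G
  & forall W, nbhs (xF F) W -> local_normal_form D (xF F) (n - #|active N b (xF F)|) q W].
  have [fF|nfF] := pselect (face D F); last by exists (cst 0).
  have [y /mapP[G]|q [Cq qx qF qG qW]] :=
      face_model irr simpleD dimD fF (gF F fF) (al := alpha F)
      (pts := [seq (xF G, alpha G) | G <- s & G != F]).
    rewrite mem_filter => /andP[GF /sP fG] -> /=.
    split; first exact: subD fG (gF G fG).1.
    move=> FG; apply: alpha_lt => //; rewrite properEneq; split=> //.
    exact: (generic_subface fF (gF F fF) fG (gF G fG) FG).
  exists q => _; split=> // G fG GF.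
  apply: (qG (xF G, alpha G)); apply/mapP; exists G => //.
  by rewrite mem_filter GF; apply/sP.
(* One [e] is the margin demanded by [regularized_max]; the other makes it strict at [xF F], hence
   valid nearby by continuity. *)
have [e e0 gap] : exists2 e, 0 < e & forall F G, face D F -> face D G -> G != F ->
    q G (xF F) + e + e <= alpha F.
  have [[F G] /allpairsP[[F' G'] /= [/sP fF /sP fG [-> ->]]]|e e0 He] := @seq_small_enough R _
    [seq (F, G) | F <- s, G <- s] (fun FG d => FG.2 != FG.1 -> q FG.2 (xF FG.1) + d + d <= alpha FG.1).
    have [->|GF] := eqVneq G' F'; first by exists 1.
    have [_ _ _ qG _] := qP G' fG.
    have H : q G' (xF F') < alpha F' by apply: qG => //; rewrite eq_sym.
    exists ((alpha F' - q G' (xF F')) / 2); first by rewrite divr_gt0 // subr_gt0.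
    by move=> d /andP[d0 dle] _; lra.
  exists e => // F G fF fG GF; apply: (He (F, G)) => //=; last by rewrite e0 lexx.
  by apply/allpairs_f; apply/sP.
have [q0 q0P] := irr.1.
have fD : face D D by apply: face_self; exists q0 => i; apply: ltW.
have sn0 : s != [::] by apply/eqP => sE; have /sP := fD; rewrite sE.
have Cq F : F \in s -> smooth_convex (q F) by move=> /sP /qP[].
have [f [[Cf Tf] qf fE]] := regularized_max e0 (undup_uniq s0) sn0 Cq.
have f_near F : face D F -> \forall p \near xF F, f p = q F p.
  move=> fF; have [[CqF _] qx _ _ _] := qP F fF.
  have : \forall p \near xF F, forall G, G \in s -> G != F -> q G p + e <= q F p.
    apply: (@near_seq _ _ s (fun G p => G != F -> q G p + e <= q F p) (nbhs (xF F)) (nbhs_filter _)) => G /sP fG.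
    have [->|GF] := eqVneq G F; first by near=> p.
    have [[CqG _] _ _ _ _] := qP G fG.
    have cqG : continuous (q F - q G).
      move=> p; apply: continuousB; [exact: (CqF 0)|exact: (CqG 0)].
    have gt_e : e < (q F - q G) (xF F).
      have := gap F G fF fG GF; rewrite -qx.
      change ((q F - q G) (xF F)) with (q F (xF F) - q G (xF F)); lra.
    near=> p => _; have : e < (q F - q G) p.
      near: p; exact: (cqG (xF F) _ (lt_nbhsr gt_e)).
    change ((q F - q G) p) with (q F p - q G p); lra.
  apply: filterS => p H; apply: fE; [exact/sP|exact: H].
have fx F : face D F -> f (xF F) = alpha F.
  move=> fF; have [_ <- _ _ _] := qP F fF.
  exact: (nbhs_singleton (f_near F fF)).
have f_gt F p : face D F -> F p -> p <> xF F -> f (xF F) < f p.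
  move=> fF Fp px; have [_ _ qgt _ _] := qP F fF.
  by rewrite fx // (lt_le_trans (qgt p Fp px)) // qf //; apply/sP.
exists f; split.
- move=> x Dx; exists setT, f; split=> //; first exact: openT.
  by move=> k; apply: cdiff_C_k.
- move=> F fF; exists (xF F); split; [exact: riF|by move=> y; apply: f_gt|].
  move=> y [[Fy _] crit]; apply: contrapT => yx.
  have := Tf y (xF F); rewrite crit ?addr0.
    by rewrite leNgt f_gt.
  by rewrite addrC subrK; apply: sub_affine_span; exact: (gF F fF).1.
- move=> F fF; split; [exact: riF| |exact: fx].
  move=> y [Fy _]; have [->//|/eqP yx] := eqVneq y (xF F).
  by apply: ltW; apply: f_gt.
- move=> F l fF diml; have [_ _ _ _ qW] := qP F fF.
  have lE : l = (n - #|active N b (xF F)|)%N.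
    rewrite -(simple_active_rank irr simpleD dimD fF (gF F fF)).
    apply: has_dim_uniq diml (generic_has_dim fF (gF F fF)) _.
    by exists (xF F); exact: (gF F fF).1.
  have [e1 [U [A [b' [e10 [UD UW xU] AP UE [r [c [r0 qE]]]]]]]] := qW _ (f_near F fF).
  exists e1, U, A, b'; rewrite lE; split=> //; exists r, c; split=> // p Up.
  by rewrite (UW p Up) qE.
Unshelve. all: end_near. Qed.

(** The number of constraints active at a generic point strictly increases on passing to a proper
    subface, so it can serve as [alpha]. *)
Lemma face_data_exists : exists xF alpha, face_data D xF alpha.
Proof.
have /choice[xF gF] F : exists x, face D F -> generic_point N b F x.
  have [fF|nfF] := pselect (face D F); last by exists 0.
  have [x gx] := generic_exists fF (fun p r Fp Fr => face_midpoint fF Fp Fr).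
  by exists x.
exists xF, (fun F => #|active N b (xF F)|%:R); split=> [F fF|F fF|F F' fF fF' F'F].
- exact: generic_rel_int (gF F fF).
- exact: ler0n.
have [F'F1 F'F2] := F'F; rewrite ltr_nat; apply: proper_card.
have sub : active N b (xF F) \subset active N b (xF F').
  apply/fintype.subsetP => i; rewrite !inE => /eqP xi; apply/eqP.
  by apply: (gF F fF).2 => //; apply: F'F1; exact: (gF F' fF').1.
rewrite finset.properEneq sub andbT; apply/eqP => E; apply: F'F2 => p.
rewrite (generic_face_eq fF (gF F fF)) (generic_face_eq fF' (gF F' fF')) => -[Dp p0].
split=> // i xi; apply: p0; apply/eqP.
by move/setP: E => /(_ i); rewrite !inE xi eqxx.
Qed.

End Assembly.

Theorem propositionA1 (R : realType) (n : nat) (D : set 'rV[R]_n)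
    (simpleD : simple_polytope D) (dimD : has_dim D n) :
  (exists f : 'rV[R]_n -> R, smooth_on D f /\ property_A D f) /\
  (forall (xF : set 'rV[R]_n -> 'rV[R]_n) (alpha : set 'rV[R]_n -> R),
     face_data D xF alpha ->
     exists f : 'rV[R]_n -> R,
       [/\ smooth_on D f, property_A D f, property_B D xF alpha f
         & property_C D xF f]).
Proof.
have [m [N [b [DE irr]]]] := irredundant_representation simpleD.1 dimD.
subst D; split; last exact: prescribed_function.
have [xF [alpha dat]] := face_data_exists N b.
by have [f [sf Af _ _]] := prescribed_function irr simpleD dimD dat; exists f.
Qed.
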